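(* Let $u_1,\dots,u_N\in\mathbb C^\times$ satisfy $$\frac{u_i}{u_j}\ne q_1^k\quad\text{for all }1\le i<j\le N,\ k\in\mathbb Z.$$ Then the comultiplication rule, i.e. the formulas $$(1-q_1)e(z)([u_1]_{i_1}\otimes\dots\otimes[u_N]_{i_N})=\sum_{s=1}^N\Big(\prod_{l=1}^{s-1}\gamma_{i_l,u_l}(q_1^{i_s}u_s)\Big)\delta(q_1^{i_s}u_s/z)\,[u_1]_{i_1}\otimes\dots\otimes[u_s]_{i_s+1}\otimes\dots\otimes[u_N]_{i_N},$$ $$-(1-q_1^{-1})f(z)([u_1]_{i_1}\otimes\dots\otimes[u_N]_{i_N})=\sum_{s=1}^N\delta(q_1^{i_s-1}u_s/z)\Big(\prod_{l=s+1}^N\gamma_{i_l,u_l}(q_1^{i_s-1}u_s)\Big)[u_1]_{i_1}\otimes\dots\otimes[u_s]_{i_s-1}\otimes\dots\otimes[u_N]_{i_N},$$ $$\psi^\pm(z)([u_1]_{i_1}\otimes\dots\otimes[u_N]_{i_N})=\psi^\pm(z)[u_1]_{i_1}\otimes\dots\otimes\psi^\pm(z)[u_N]_{i_N},$$ defines the structure of an $\mathcal E$-module on the tensor product $V(u_1)\otimes\dots\otimes V(u_N)$.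
   Context: Let $q_1,q_2,q_3\in\mathbb C^\times$ with $q_i\ne1$, $q_1q_2q_3=1$. Put $g(z,w)=(z-q_1w)(z-q_2w)(z-q_3w)$. $\mathcal E$ is the unital associative $\mathbb C$-algebra generated by $e_i,f_i$ ($i\in\mathbb Z$), $\psi^+_j,\psi^-_{-j}$ ($j>0$) and $(\psi_0^{\pm})^{\pm1}$. With $e(z)=\sum_{i\in\mathbb Z}e_iz^{-i}$, $f(z)=\sum_{i\in\mathbb Z}f_iz^{-i}$, $\psi^\pm(z)=\sum_{\pm i\ge0}\psi^\pm_iz^{-i}$, $\delta(z)=\sum_{n\in\mathbb Z}z^n$, the defining relations (understood coefficientwise) are $$g(z,w)e(z)e(w)=-g(w,z)e(w)e(z),\quad g(w,z)f(z)f(w)=-g(z,w)f(w)f(z),$$ $$g(z,w)\psi^\pm(z)e(w)=-g(w,z)e(w)\psi^\pm(z),\quad g(w,z)\psi^\pm(z)f(w)=-g(z,w)f(w)\psi^\pm(z),$$ $$[e(z),f(w)]=\frac{\delta(z/w)}{g(1,1)}(\psi^+(z)-\psi^-(z)),\quad [\psi^\pm_i,\psi^\pm_j]=0,\ [\psi^\pm_i,\psi^\mp_j]=0,$$ $$\psi^\pm_0(\psi^\pm_0)^{-1}=(\psi^\pm_0)^{-1}\psi^\pm_0=1,\quad [e_0,[e_1,e_{-1}]]=0,\quad [f_0,[f_1,f_{-1}]]=0.$$ For $u\in\mathbb C^\times$, $V(u)$ is the vector space with basis $[u]_i$ ($i\in\mathbb Z$), and $$\gamma_{i,u}(z)=\frac{(1-q_3q_1^iu/z)(1-q_2q_1^iu/z)}{(1-q_1^{i-1}u/z)(1-q_1^iu/z)},\qquad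 \psi^\pm(z)[u]_i=\gamma_{i,u}^\pm(z)[u]_i,$$ where $\gamma^+(z)$, $\gamma^-(z)$ denote the expansions of a rational function at $z=\infty$ and $z=0$. The displayed formulas in the claim are obtained from the (formal) comultiplication $\Delta e(z)=e(z)\otimes1+\psi^-(z)\otimes e(z)$, $\Delta f(z)=f(z)\otimes\psi^+(z)+1\otimes f(z)$, $\Delta\psi^\pm(z)=\psi^\pm(z)\otimes\psi^\pm(z)$ by evaluating rational functions at the supports of delta functions. *)

(* Defs.v *)
From HB Require Import structures.
From mathcomp Require Import all_boot all_order all_algebra finmap.
From mathcomp Require Import generic_quotient boolp reals complex monalg.

Set Implicit Arguments.
Unset Strict Implicit.
Unset Printing Implicit Defensive.

Import Order.TTheory GRing.Theory Num.Theory.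
Local Open Scope ring_scope.
Local Open Scope quotient_scope.

Declare Scope expr_scope.
Delimit Scope expr_scope with X.

(** * Algebras presented by generators and relations *)

(* Noncommutative polynomial expressions over F in the generators X: the free
   algebra F<X> is their quotient by the algebra axioms, and an algebra with
   defining relations [rel] is their quotient by the least congruence
   [expr_eq rel] containing the algebra axioms and [rel]. *)
Section Presentation.
Variables (F : fieldType) (X : Type).

Inductive expr : Type :=
  | Gen of X
  | Const of F
  | Add of expr & expr
  | Mul of expr & expr.

HB.instance Definition _ := gen_eqMixin expr.
HB.instance Definition _ := gen_choiceMixin expr.

Variable rel : expr -> expr -> Prop.

Inductive expr_eq : expr -> expr -> Prop :=
  | EqRel x y : rel x y -> expr_eq x y
  | EqRefl x : expr_eq x x
  | EqSym x y : expr_eq x y -> expr_eq y x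
  | EqTrans x y z : expr_eq x y -> expr_eq y z -> expr_eq x z
  | EqAdd x x' y y' :
      expr_eq x x' -> expr_eq y y' -> expr_eq (Add x y) (Add x' y')
  | EqMul x x' y y' :
      expr_eq x x' -> expr_eq y y' -> expr_eq (Mul x y) (Mul x' y')
  | EqAddA x y z : expr_eq (Add x (Add y z)) (Add (Add x y) z)
  | EqAddC x y : expr_eq (Add x y) (Add y x)
  | EqAdd0 x : expr_eq (Add (Const 0) x) x
  | EqMulA x y z : expr_eq (Mul x (Mul y z)) (Mul (Mul x y) z)
  | EqMul1 x : expr_eq (Mul (Const 1) x) x
  | EqMul0 x : expr_eq (Mul (Const 0) x) (Const 0)
  | EqMulDl x y z : expr_eq (Mul (Add x y) z) (Add (Mul x z) (Mul y z))
  | EqMulDr x y z : expr_eq (Mul x (Add y z)) (Add (Mul x y) (Mul x z))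
  | EqConstC c x : expr_eq (Mul (Const c) x) (Mul x (Const c))
  | EqConstD c d : expr_eq (Const (c + d)) (Add (Const c) (Const d))
  | EqConstM c d : expr_eq (Const (c * d)) (Mul (Const c) (Const d)).

Definition expr_eqb (x y : expr) : bool := `[< expr_eq x y >].

Fact expr_eqb_equiv : equiv_class_of expr_eqb.
Proof.
split=> [x|x y|y x z]; first exact/asboolP/EqRefl.
  by apply/asboolP/asboolP => /EqSym.
by move=> /asboolP xy /asboolP yz; apply/asboolP/(EqTrans xy).
Qed.
Canonical expr_eqb_equiv_rel := EquivRelPack expr_eqb_equiv.
Canonical expr_eqb_encModRel := defaultEncModRel expr_eqb.

Definition presalg : Type := {eq_quot expr_eqb}.
HB.instance Definition _ := Choice.on presalg.

Definition presalg_pi (x : expr) : presalg := \pi_({eq_quot expr_eqb}) x.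
Definition presalg_repr (x : presalg) : expr :=
  repr (x : {eq_quot expr_eqb}).

Lemma presalg_reprK (x : presalg) : presalg_pi (presalg_repr x) = x.
Proof. exact: reprK. Qed.

Lemma presalg_eqP x y : presalg_pi x = presalg_pi y <-> expr_eq x y.
Proof.
split=> [/eqP|xy]; last apply/eqP; rewrite /presalg_pi eqmodE.
  by move/asboolP.
exact/asboolP.
Qed.

Lemma presalg_ind (P : presalg -> Prop) :
  (forall x, P (presalg_pi x)) -> forall x, P x.
Proof. by move=> Ppi x; rewrite -(presalg_reprK x). Qed.

Definition presalg_zero : presalg := presalg_pi (Const 0).
Definition presalg_one : presalg := presalg_pi (Const 1).
Definition presalg_add (x y : presalg) : presalg :=
  presalg_pi (Add (presalg_repr x) (presalg_repr y)).
Definition presalg_mul (x y : presalg) : presalg :=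
  presalg_pi (Mul (presalg_repr x) (presalg_repr y)).
Definition presalg_scale (c : F) (x : presalg) : presalg :=
  presalg_pi (Mul (Const c) (presalg_repr x)).
Definition presalg_opp (x : presalg) : presalg := presalg_scale (- 1) x.

Fact presalg_repr_pi x : expr_eq (presalg_repr (presalg_pi x)) x.
Proof. exact/presalg_eqP/presalg_reprK. Qed.

Fact presalg_addE x y :
  presalg_add (presalg_pi x) (presalg_pi y) = presalg_pi (Add x y).
Proof. by apply/presalg_eqP/EqAdd; apply: presalg_repr_pi. Qed.
Fact presalg_mulE x y :
  presalg_mul (presalg_pi x) (presalg_pi y) = presalg_pi (Mul x y).
Proof. by apply/presalg_eqP/EqMul; apply: presalg_repr_pi. Qed.
Fact presalg_scaleE c x :
  presalg_scale c (presalg_pi x) = presalg_pi (Mul (Const c) x).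
Proof. by apply/presalg_eqP/EqMul; [apply: EqRefl | apply: presalg_repr_pi]. Qed.

Fact presalg_addA : associative presalg_add.
Proof.
elim/presalg_ind=> x; elim/presalg_ind=> y; elim/presalg_ind=> z.
by rewrite !presalg_addE; apply/presalg_eqP/EqAddA.
Qed.
Fact presalg_addC : commutative presalg_add.
Proof.
elim/presalg_ind=> x; elim/presalg_ind=> y.
by rewrite !presalg_addE; apply/presalg_eqP/EqAddC.
Qed.
Fact presalg_add0 : left_id presalg_zero presalg_add.
Proof.
by elim/presalg_ind=> x; rewrite presalg_addE; apply/presalg_eqP/EqAdd0.
Qed.
Fact presalg_addN : left_inverse presalg_zero presalg_opp presalg_add.
Proof.
elim/presalg_ind=> x; rewrite /presalg_opp presalg_scaleE presalg_addE.
apply/presalg_eqP; apply: EqTrans (EqMul0 x).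
apply: EqTrans (EqAdd (EqRefl _) (EqSym (EqMul1 x))) _.
apply: EqTrans (EqSym (EqMulDl _ _ _)) _; apply: EqMul (EqRefl x).
by have := EqSym (EqConstD (- 1) 1); rewrite addNr.
Qed.
HB.instance Definition _ := GRing.isZmodule.Build presalg
  presalg_addA presalg_addC presalg_add0 presalg_addN.

Fact presalg_mulA : associative presalg_mul.
Proof.
elim/presalg_ind=> x; elim/presalg_ind=> y; elim/presalg_ind=> z.
by rewrite !presalg_mulE; apply/presalg_eqP/EqMulA.
Qed.
Fact presalg_mul1 : left_id presalg_one presalg_mul.
Proof.
by elim/presalg_ind=> x; rewrite presalg_mulE; apply/presalg_eqP/EqMul1.
Qed.
Fact presalg_mulr1 : right_id presalg_one presalg_mul.
Proof.
elim/presalg_ind=> x; rewrite presalg_mulE; apply/presalg_eqP.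
exact: EqTrans (EqSym (EqConstC _ _)) (EqMul1 x).
Qed.
Fact presalg_mulDl : left_distributive presalg_mul presalg_add.
Proof.
elim/presalg_ind=> x; elim/presalg_ind=> y; elim/presalg_ind=> z.
by rewrite presalg_addE !presalg_mulE presalg_addE; apply/presalg_eqP/EqMulDl.
Qed.
Fact presalg_mulDr : right_distributive presalg_mul presalg_add.
Proof.
elim/presalg_ind=> x; elim/presalg_ind=> y; elim/presalg_ind=> z.
by rewrite presalg_addE !presalg_mulE presalg_addE; apply/presalg_eqP/EqMulDr.
Qed.
HB.instance Definition _ := GRing.Zmodule_isPzRing.Build presalg
  presalg_mulA presalg_mul1 presalg_mulr1 presalg_mulDl presalg_mulDr.

Fact presalg_scaleA c d x :
  presalg_scale c (presalg_scale d x) = presalg_scale (c * d) x.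
Proof.
elim/presalg_ind: x => x; rewrite !presalg_scaleE; apply/presalg_eqP.
apply: EqTrans (EqMulA _ _ _) _.
exact: EqMul (EqSym (EqConstM _ _)) (EqRefl x).
Qed.
Fact presalg_scale1 : left_id 1 presalg_scale.
Proof.
by elim/presalg_ind=> x; rewrite presalg_scaleE; apply/presalg_eqP/EqMul1.
Qed.
Fact presalg_scaleDr : right_distributive presalg_scale presalg_add.
Proof.
move=> c; elim/presalg_ind=> x; elim/presalg_ind=> y.
rewrite presalg_addE !presalg_scaleE presalg_addE.
exact/presalg_eqP/EqMulDr.
Qed.
Fact presalg_scaleDl x c d :
  presalg_scale (c + d) x = presalg_add (presalg_scale c x) (presalg_scale d x).
Proof.
elim/presalg_ind: x => x; rewrite !presalg_scaleE presalg_addE.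
apply/presalg_eqP; apply: EqTrans (EqMulDl _ _ _).
exact: EqMul (EqConstD _ _) (EqRefl x).
Qed.
HB.instance Definition _ := GRing.Zmodule_isLmodule.Build F presalg
  presalg_scaleA presalg_scale1 presalg_scaleDr presalg_scaleDl.

Lemma presalg_scaleAl c (x y : presalg) : c *: (x * y) = (c *: x) * y.
Proof.
elim/presalg_ind: x => x; elim/presalg_ind: y => y.
change (presalg_scale c (presalg_mul (presalg_pi x) (presalg_pi y))
  = presalg_mul (presalg_scale c (presalg_pi x)) (presalg_pi y)).
rewrite presalg_mulE !presalg_scaleE presalg_mulE.
exact/presalg_eqP/EqMulA.
Qed.
Lemma presalg_scaleAr c (x y : presalg) : c *: (x * y) = x * (c *: y).
Proof.
elim/presalg_ind: x => x; elim/presalg_ind: y => y.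
change (presalg_scale c (presalg_mul (presalg_pi x) (presalg_pi y))
  = presalg_mul (presalg_pi x) (presalg_scale c (presalg_pi y))).
rewrite presalg_mulE !presalg_scaleE presalg_mulE; apply/presalg_eqP.
apply: EqTrans (EqMulA _ _ _) _; apply: EqTrans _ (EqSym (EqMulA _ _ _)).
exact: EqMul (EqConstC _ _) (EqRefl y).
Qed.

Lemma presalg_piD x y : presalg_pi (Add x y) = presalg_pi x + presalg_pi y.
Proof. by rewrite -presalg_addE. Qed.
Lemma presalg_piM x y : presalg_pi (Mul x y) = presalg_pi x * presalg_pi y.
Proof. by rewrite -presalg_mulE. Qed.
Lemma presalg_piC c : presalg_pi (Const c) = c *: (1 : presalg).
Proof.
change (presalg_pi (Const c) = presalg_scale c (presalg_pi (Const 1))).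
rewrite presalg_scaleE; apply/presalg_eqP.
exact: EqTrans (EqSym (EqMul1 _)) (EqConstC _ _).
Qed.

End Presentation.

Bind Scope expr_scope with expr.
Arguments Gen {F X}.
Arguments Const {F X}.

Definition Scale (F : fieldType) X (c : F) (x : expr F X) := Mul (Const c) x.
Definition Opp (F : fieldType) X (x : expr F X) := Scale (- 1) x.

Notation "x + y" := (Add x y) : expr_scope.
Notation "x * y" := (Mul x y) : expr_scope.
Notation "- x" := (Opp x) : expr_scope.
Notation "x - y" := (Add x (Opp y)) : expr_scope.
Notation "c *: x" := (Scale c x) : expr_scope.

Record algebra_action (F : fieldType) (A : algType F) (V : lmodType F)
    (act : A -> V -> V) : Prop := AlgebraAction {
  action_linearr : forall a, linear (act a);
  action_linearl : forall v, linear (act^~ v);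
  action1 : forall v, act 1 v = v;
  actionM : forall a b v, act (a * b) v = act a (act b v)
}.

(** * The algebra E *)

Section Algebra.
Variables (F : fieldType) (q1 q2 q3 : F).

Definition g (z w : F) : F := (z - q1 * w) * (z - q2 * w) * (z - q3 * w).

(* [Ge n], [Gf n] are e_n, f_n; [Gpsi true k] is psi^+_k and [Gpsi false k] is
   psi^-_{-k}; [GpsiV b] is the inverse of the corresponding psi^{+/-}_0. *)
Inductive Egen : Type :=
  | Ge of int
  | Gf of int
  | Gpsi of bool & nat
  | GpsiV of bool.

Local Notation expr := (expr F Egen).
Local Open Scope expr_scope.

(* Formal series are indexed by minus the exponent: [s n] is the coefficient
   of z^{-n}, and [s m n] the coefficient of z^{-m} w^{-n}. *)

(* (z - q w) s(z, w) and (w - q z) s(z, w) *)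
Definition mul_zBqw (q : F) (s : int -> int -> expr) (m n : int) : expr :=
  s (m + 1)%R n - q *: s m (n + 1)%R.
Definition mul_wBqz (q : F) (s : int -> int -> expr) (m n : int) : expr :=
  s m (n + 1)%R - q *: s (m + 1)%R n.

Definition mul_gzw (s : int -> int -> expr) : int -> int -> expr :=
  mul_zBqw q1 (mul_zBqw q2 (mul_zBqw q3 s)).
Definition mul_gwz (s : int -> int -> expr) : int -> int -> expr :=
  mul_wBqz q1 (mul_wBqz q2 (mul_wBqz q3 s)).

(* delta(z / w) s(z) = sum_{k, l} s_l z^{k - l} w^{-k} *)
Definition mul_deltazw (s : int -> expr) (m n : int) : expr := s (m + n)%R.

Definition e_series (n : int) : expr := Gen (Ge n).
Definition f_series (n : int) : expr := Gen (Gf n).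
Definition psi_series (b : bool) (n : int) : expr :=
  if 0 <= (if b then n else (- n)%R) then Gen (Gpsi b `|n|) else Const 0.

Local Notation e := e_series.
Local Notation f := f_series.
Local Notation psi := psi_series.

Definition bracket (x y : expr) : expr := x * y - y * x.

Inductive Erel : expr -> expr -> Prop :=
  | Erel_ee m n : Erel
      (mul_gzw (fun m n => e m * e n) m n)
      (- mul_gwz (fun m n => e n * e m) m n)
  | Erel_ff m n : Erel
      (mul_gwz (fun m n => f m * f n) m n)
      (- mul_gzw (fun m n => f n * f m) m n)
  | Erel_psie b m n : Erel
      (mul_gzw (fun m n => psi b m * e n) m n)
      (- mul_gwz (fun m n => e n * psi b m) m n)
  | Erel_psif b m n : Erel
      (mul_gwz (fun m n => psi b m * f n) m n)
      (- mul_gzw (fun m n => f n * psi b m) m n)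
  | Erel_ef m n : Erel
      (bracket (e m) (f n))
      (((g 1 1)^-1)%R *: mul_deltazw (fun k => psi true k - psi false k) m n)
  | Erel_psipsi b c j k : Erel
      (bracket (Gen (Gpsi b j)) (Gen (Gpsi c k)))
      (Const 0)
  | Erel_psiV b : Erel (Gen (Gpsi b 0) * Gen (GpsiV b)) (Const 1)
  | Erel_Vpsi b : Erel (Gen (GpsiV b) * Gen (Gpsi b 0)) (Const 1)
  | Erel_eee : Erel (bracket (e 0) (bracket (e 1) (e (- 1)%R))) (Const 0)
  | Erel_fff : Erel (bracket (f 0) (bracket (f 1) (f (- 1)%R))) (Const 0).

Local Close Scope expr_scope.

Definition Ealg : Type := presalg Erel.
HB.instance Definition _ := GRing.PzRing.on Ealg.
HB.instance Definition _ := GRing.Lmodule.on Ealg.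

Definition Ee (n : int) : Ealg := presalg_pi Erel (Gen (Ge n)).
Definition Ef (n : int) : Ealg := presalg_pi Erel (Gen (Gf n)).
Definition Epsi (b : bool) (k : nat) : Ealg := presalg_pi Erel (Gen (Gpsi b k)).

(* [Ealg] is not zero: it has the one-dimensional representation with
   e = f = 0 and psi^+(z) = psi^-(z) = 1. *)
Fixpoint augm (x : expr) : F :=
  match x with
  | Gen (Gpsi _ 0) | Gen (GpsiV _) => 1
  | Gen _ => 0
  | Const c => c
  | Add x y => augm x + augm y
  | Mul x y => augm x * augm y
  end.

Fact augmN x : augm (- x)%X = - augm x.
Proof. by rewrite /= mulN1r. Qed.

Fact augm_psi b n : augm (psi b n) = (n == 0)%:R.
Proof. by rewrite /psi_series; case: b n => [] [[|n]|n]. Qed.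

Fact augm_gzw0 s m n :
  (forall m n, augm (s m n) = 0) -> augm (mul_gzw s m n) = 0.
Proof.
have H q r : (forall m n, augm (r m n) = 0) ->
    forall m n, augm (mul_zBqw q r m n) = 0.
  by move=> r0 a b /=; rewrite !r0 !mulr0 addr0.
by move=> s0; do 3!apply: (H).
Qed.

Fact augm_gwz0 s m n :
  (forall m n, augm (s m n) = 0) -> augm (mul_gwz s m n) = 0.
Proof.
have H q r : (forall m n, augm (r m n) = 0) ->
    forall m n, augm (mul_wBqz q r m n) = 0.
  by move=> r0 a b /=; rewrite !r0 !mulr0 addr0.
by move=> s0; do 3!apply: (H).
Qed.

Fact augm_rel x y : Erel x y -> augm x = augm y.
Proof.
have bracket0 a b : augm (bracket a b) = 0.
  by rewrite /= mulN1r mulrC subrr.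
case=> [m n|m n|b m n|b m n|m n|b c j k|b|b||].
- rewrite augmN augm_gzw0 ?augm_gwz0 ?oppr0 // => *; exact: mul0r.
- rewrite augmN augm_gwz0 ?augm_gzw0 ?oppr0 // => *; exact: mul0r.
- rewrite augmN augm_gzw0 ?augm_gwz0 ?oppr0 // => *; [exact: mul0r|exact: mulr0].
- rewrite augmN augm_gwz0 ?augm_gzw0 ?oppr0 // => *; [exact: mul0r|exact: mulr0].
- by rewrite bracket0 /mul_deltazw /= !augm_psi mulN1r subrr mulr0.
- exact: bracket0.
- exact: mulr1.
- exact: mulr1.
- exact: bracket0.
- exact: bracket0.
Qed.

Fact augm_eq x y : expr_eq Erel x y -> augm x = augm y.
Proof.
elim=> //=.
- exact: augm_rel.
- by move=> a b c _ -> _ ->.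
- by move=> a a' b b' _ -> _ ->.
- by move=> a a' b b' _ -> _ ->.
- by move=> *; rewrite addrA.
- by move=> *; rewrite addrC.
- by move=> *; rewrite add0r.
- by move=> *; rewrite mulrA.
- by move=> *; rewrite mul1r.
- by move=> *; rewrite mul0r.
- by move=> *; rewrite mulrDl.
- by move=> *; rewrite mulrDr.
- by move=> *; rewrite mulrC.
Qed.

Fact Ealg_one_neq0 : (1 : Ealg) != 0.
Proof.
apply/eqP => E10.
have /presalg_eqP/augm_eq /eqP :
  presalg_pi Erel (Const 1) = presalg_pi Erel (Const 0) by exact: E10.
by rewrite oner_eq0.
Qed.
HB.instance Definition _ := GRing.PzSemiRing_isNonZero.Build Ealg Ealg_one_neq0.
HB.instance Definition _ :=
  GRing.LSemiModule_isLSemiAlgebra.Build F Ealg (@presalg_scaleAl _ _ Erel).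
HB.instance Definition _ :=
  GRing.LSemiAlgebra_isSemiAlgebra.Build F Ealg (@presalg_scaleAr _ _ Erel).

End Algebra.

(** * The spaces V(u) and their tensor products *)

(* The Taylor coefficients at T = 0 of the rational function p / d of T,
   assuming d(0) != 0. *)
Section Taylor.
Variables (F : fieldType) (p d : {poly F}).

Fixpoint taylor_seq (n : nat) : seq F :=
  if n is m.+1 then
    let s := taylor_seq m in
    rcons s ((p`_m - \sum_(k < m) d`_(m - k) * s`_k) / d`_0)
  else [::].

Definition taylor (n : nat) : F := (taylor_seq n.+1)`_n.

Lemma size_taylor_seq n : size (taylor_seq n) = n.
Proof. by elim: n => //= n IHn; rewrite size_rcons IHn. Qed.

Lemma nth_taylor_seq n k : (k < n)%N -> (taylor_seq n)`_k = taylor k.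
Proof.
elim: n => // n IHn; rewrite ltnS leq_eqVlt => /orP[/eqP-> //|lt_kn].
by rewrite /= nth_rcons size_taylor_seq lt_kn IHn.
Qed.

Lemma taylorP n : d`_0 != 0 -> \sum_(k < n.+1) d`_(n - k) * taylor k = p`_n.
Proof.
move=> d0; rewrite big_ord_recr /= subnn {2}/taylor /=.
rewrite nth_rcons size_taylor_seq ltnn eqxx mulrC divfK //.
rewrite (eq_bigr (fun k : 'I_n => d`_(n - k) * (taylor_seq n)`_k)).
  by rewrite addrC subrK.
by move=> k _; rewrite nth_taylor_seq.
Qed.

End Taylor.

Section Modules.
Variables (F : fieldType) (q1 q2 q3 : F).

(* gamma_{i,u}(z) as a quotient of polynomials in T = 1 / z *)
Definition gamma_num (i : int) (u : F) : {poly F} :=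
  (1 - (q3 * q1 ^ i * u) *: 'X) * (1 - (q2 * q1 ^ i * u) *: 'X).
Definition gamma_den (i : int) (u : F) : {poly F} :=
  (1 - (q1 ^ (i - 1) * u) *: 'X) * (1 - (q1 ^ i * u) *: 'X).

Definition gamma (i : int) (u z : F) : F :=
  (gamma_num i u).[z^-1] / (gamma_den i u).[z^-1].

(* z^2 p(1 / z), as a polynomial in z *)
Definition rev2 (p : {poly F}) : {poly F} := \poly_(k < 3) p`_(2 - k).

(* [gamma_coef true i u k] is the coefficient of z^{-k} in gamma^+_{i,u}(z), and
   [gamma_coef false i u k] is the coefficient of z^k in gamma^-_{i,u}(z). *)
Definition gamma_coef (b : bool) (i : int) (u : F) (k : nat) : F :=
  if b then taylor (gamma_num i u) (gamma_den i u) k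
  else taylor (rev2 (gamma_num i u)) (rev2 (gamma_den i u)) k.

Definition delta_coef (a : F) (n : int) : F := a ^ n.

(* The space underlying V(u) does not depend on u. *)
Definition Vspace : lmodType F := {malg F[int]}.
Definition Vbasis (i : int) : Vspace := << i >>.

Definition Vpsi (b : bool) (u : F) (k : nat) (i : int) : Vspace :=
  gamma_coef b i u k *: Vbasis i.

Section Tensor.
Variable N : nat.

(* The N-fold tensor power of a space with basis indexed by int, modelled as
   the space with basis indexed by int^N. *)
Definition Vtensor : lmodType F := {malg F[{ffun 'I_N -> int}]}.

Definition tensor (v : 'I_N -> Vspace) : Vtensor :=
  \sum_(k : {dffun forall s : 'I_N, msupp (v s)})
     << \prod_s (v s)@_(val (k s)) *g [ffun s => val (k s)] >>.

Lemma tensorE (v : 'I_N -> Vspace) (i : {ffun 'I_N -> int}) :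
  (tensor v)@_i = \prod_s (v s)@_(i s).
Proof.
rewrite /tensor raddf_sum /=.
under eq_bigr => k _ do rewrite mcoeffU.
case: (boolP [forall s, i s \in msupp (v s)]) => [/forallP iv|].
  pose k0 : {dffun forall s : 'I_N, msupp (v s)} := [ffun s => [` iv s]%fset].
  have k0E : [ffun s => val (k0 s)] = i by apply/ffunP => s; rewrite !ffunE.
  rewrite (bigD1 k0) //= k0E eqxx mulr1n [X in _ + X]big1 ?addr0.
    by apply: eq_bigr => s _; rewrite ffunE.
  move=> k /eqP kk0; case: eqP => // ki; case: kk0.
  apply/ffunP => s; apply: val_inj.
  by rewrite ffunE /= -ki ffunE.
rewrite negb_forall => /existsP[s si]; rewrite big1.
  by rewrite (bigD1 s) //= mcoeff_outdom // mul0r.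
move=> k _; case: eqP => // ki; case/negP: si; rewrite -ki ffunE; exact: valP.
Qed.

Definition tbasis (i : {ffun 'I_N -> int}) : Vtensor :=
  tensor (fun s => Vbasis (i s)).

Lemma tbasisE (i : {ffun 'I_N -> int}) : tbasis i = << i >>.
Proof.
apply/malgP => j; rewrite tensorE mcoeffU.
under eq_bigr => s _ do rewrite mcoeffU.
have [->|ij] := eqVneq i j; first by rewrite big1 // => s _; rewrite eqxx.
have /existsP[s] : [exists s, i s != j s].
  apply: contraNT ij; rewrite negb_exists => /forallP ij.
  by apply/eqP/ffunP => s; apply/eqP; rewrite -[_ == _]negbK ij.
by move/negbTE => sij; rewrite (bigD1 s) //= sij mul0r.
Qed.

Definition shift (i : {ffun 'I_N -> int}) (s : 'I_N) (d : int) :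
    {ffun 'I_N -> int} :=
  [ffun l => if l == s then i l + d else i l].

End Tensor.
End Modules.

(* Main.v *)
Require Import Defs.
From HB Require Import structures.
From mathcomp Require Import all_boot all_order all_algebra finmap ring zify.
From mathcomp Require Import boolp reals complex monalg.

Set Implicit Arguments.
Unset Strict Implicit.
Unset Printing Implicit Defensive.

Import Order.TTheory GRing.Theory Num.Theory.
Local Open Scope ring_scope.

(** On a basis vector of the tensor product, psi(z) acts by the expansions of
    the product of the functions gamma of the factors, while e(z) and f(z) move
    one factor at a time, with delta functions as coefficients.  Comparing the
    coefficients of a product of delta functions turns each relation of the
    algebra into an identity between values of rational functions at the points
    q1^i u of the factors.  The hypothesis on u says that the quotient of the
    points of two factors is never a power of q1, so that no value is taken at a
    pole.

    Let gamma(x, y) be the value at y of the function gamma of a factor at the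
    point x ([gamma_at]).  The condition q1 q2 q3 = 1 gives
    gamma(q1 x, y) = gamma(y, x) ([gamma_at_shift]).  Hence moving first the
    factor s and then the factor t costs gamma(a_t, a_s) whichever of the two
    comes first in the tensor product ([weight_factor_exchange]), although the
    comultiplication is not symmetric.  The quadratic relation is then the
    antisymmetry of g(x, y) gamma(x, y) ([gamma_at_antisym]), and the Serre
    relation is an identity between six rational functions of three points
    ([serre_distinct]), together with the versions where one factor moves
    two or three times ([serre_double], [serre_triple]).

    Replacing each q by its inverse and reversing the order of the factors
    exchanges e and f, and leaves gamma unchanged ([gamma_at_dual]).  The two
    currents are therefore instances of a single family of operators, for which
    the quadratic and Serre relations are proved once.

    The eigenvalues of psi are handled as formal power series in 1/z or z.
    Their relation with e and f is the equality of the quotient of the functions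
    gamma at q1 x and x with - g(x, z) / g(z, x) ([gamma_series_shift]).  In the
    commutator of e and f the terms that move two different factors cancel, again
    by [gamma_at_shift].  The remaining diagonal terms are delta functions at the
    poles of the product of the functions gamma; these poles are simple, and a
    partial fraction decomposition, valid for values as well as for both
    expansions ([prod_partial_fractions]), identifies the result with the
    difference of the two expansions ([psi_eigenseries_difference]).

    Uniqueness holds because an action is determined by the operators of the
    generators, and those of the inverses of psi_0 by those of psi_0. *)

(** * The parameters *)

Section ThreeFactors.
Variables (F : fieldType) (q1 q2 q3 : F).
Hypothesis q123 : q1 * q2 * q3 = 1.

Lemma factor1_neq0 : q1 != 0.
Proof. by apply: contra_eq_neq q123 => ->; rewrite !mul0r eq_sym oner_neq0. Qed.
Lemma factor2_neq0 : q2 != 0.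
Proof. by apply: contra_eq_neq q123 => ->; rewrite mulr0 mul0r eq_sym oner_neq0. Qed.
Lemma factor3_neq0 : q3 != 0.
Proof. by apply: contra_eq_neq q123 => ->; rewrite mulr0 eq_sym oner_neq0. Qed.
Lemma factor3E : q3 = (q1 * q2)^-1.
Proof.
have q12 : q1 * q2 != 0 by rewrite mulf_neq0 ?factor1_neq0 ?factor2_neq0.
by apply: (mulfI q12); rewrite q123 divff.
Qed.

End ThreeFactors.

(** * Formal power series *)

Section PowerSeries.
Variable F : fieldType.

Definition series : Type := nat -> F.

HB.instance Definition _ := gen_eqMixin series.
HB.instance Definition _ := gen_choiceMixin series.

Implicit Types d f g h : series.

Definition series_of_poly (p : {poly F}) : series := fun n => p`_n.
Definition series_add f g : series := fun n => f n + g n.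
Definition series_opp f : series := fun n => - f n.
Definition series_mul f g : series := fun n => \sum_(j < n.+1) f j * g (n - j)%N.

Fact series_addA : associative series_add.
Proof. by move=> f g h; apply/funext => n; exact: addrA. Qed.
Fact series_addC : commutative series_add.
Proof. by move=> f g; apply/funext => n; exact: addrC. Qed.
Fact series_add0 : left_id (series_of_poly 0) series_add.
Proof.
by move=> f; apply/funext => n; rewrite /series_add /series_of_poly coef0 add0r.
Qed.
Fact series_addN : left_inverse (series_of_poly 0) series_opp series_add.
Proof.
by move=> f; apply/funext => n; rewrite /series_add /series_of_poly coef0 addNr.
Qed.
HB.instance Definition _ := GRing.isZmodule.Build series
  series_addA series_addC series_add0 series_addN.

(** Only finitely many coefficients of the factors matter for a coefficient of
    a product, which transports the ring axioms from polynomials. *)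
Fact series_mulE f g m n : (n < m)%N ->
  series_mul f g n = ((\poly_(j < m) f j) * (\poly_(j < m) g j))`_n.
Proof.
move=> lt_nm; rewrite coefM; apply: eq_bigr => j _; rewrite !coef_poly.
by rewrite (leq_ltn_trans (leq_subr _ _) lt_nm) (leq_trans (ltn_ord j)).
Qed.

Fact series_mulC : commutative series_mul.
Proof.
by move=> f g; apply/funext => n; rewrite !(@series_mulE _ _ n.+1) // mulrC.
Qed.
Fact series_mulA : associative series_mul.
Proof.
move=> f g h; apply/funext => n.
have lhs : series_mul f (series_mul g h) n = ((\poly_(j < n.+1) f j) *
    ((\poly_(j < n.+1) g j) * (\poly_(j < n.+1) h j)))`_n.
  rewrite coefM; apply: eq_bigr => j _; rewrite coef_poly ltn_ord.
  by rewrite -series_mulE // ltnS leq_subr.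
rewrite lhs mulrA coefM; apply: eq_bigr => j _.
by rewrite -series_mulE // coef_poly ltnS leq_subr.
Qed.
Fact series_mul1 : left_id (series_of_poly 1) series_mul.
Proof.
move=> f; apply/funext => n; rewrite /series_mul /series_of_poly big_ord_recl.
by rewrite coef1 mul1r subn0 big1 ?addr0 // => j _; rewrite coef1 mul0r.
Qed.
Fact series_mulDl : left_distributive series_mul series_add.
Proof.
move=> f g h; apply/funext => n; rewrite /series_mul /series_add -big_split.
by apply: eq_bigr => j _; exact: mulrDl.
Qed.
Fact series_one_neq0 : series_of_poly 1 != series_of_poly 0.
Proof.
apply/eqP => /(congr1 (@^~ 0%N)); rewrite /series_of_poly coef0 coef1.
exact/eqP/oner_neq0.
Qed.
HB.instance Definition _ := GRing.Zmodule_isComNzRing.Build series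
  series_mulA series_mulC series_mul1 series_mulDl series_one_neq0.

Fact series_of_poly_is_zmod_morphism : zmod_morphism series_of_poly.
Proof. by move=> p q; apply/funext => n; exact: coefB. Qed.
HB.instance Definition _ := GRing.isZmodMorphism.Build {poly F} series
  series_of_poly series_of_poly_is_zmod_morphism.
Fact series_of_poly_is_monoid_morphism : monoid_morphism series_of_poly.
Proof. by split=> // p q; apply/funext => n; exact: coefM. Qed.
HB.instance Definition _ := GRing.isMonoidMorphism.Build {poly F} series
  series_of_poly series_of_poly_is_monoid_morphism.

Lemma coef_seriesD f g n : (f + g) n = f n + g n. Proof. by []. Qed.
Lemma coef_seriesB f g n : (f - g) n = f n - g n. Proof. by []. Qed.
Lemma coef_seriesM f g n : (f * g) n = \sum_(j < n.+1) f j * g (n - j)%N.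
Proof. by []. Qed.
Lemma coef_series1 n : (1 : series) n = (n == 0%N)%:R.
Proof. exact: coef1. Qed.
Lemma coef_series_sum I (r : seq I) (P : pred I) (f : I -> series) n :
  (\sum_(i <- r | P i) f i) n = \sum_(i <- r | P i) f i n.
Proof. by elim/big_rec2: _ => [|i x y _ <-] //; exact: coef0. Qed.
Lemma coef_seriesCM c f n : (series_of_poly c%:P * f) n = c * f n.
Proof.
rewrite coef_seriesM big_ord_recl subn0 big1 ?addr0 => [|j _].
  by rewrite /series_of_poly coefC.
by rewrite /series_of_poly coefC mul0r.
Qed.
Lemma coef_seriesXM f n :
  (series_of_poly 'X * f) n = if n is m.+1 then f m else 0.
Proof.
rewrite coef_seriesM /series_of_poly.
case: n => [|n]; first by rewrite big_ord1 coefX mul0r.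
rewrite !big_ord_recl !coefX mul0r add0r mul1r big1 ?addr0 => [|j _].
  by rewrite subn1.
by rewrite coefX mul0r.
Qed.

Lemma series_mul0_eq0 d f : d 0%N != 0 -> d * f = 0 -> f = 0.
Proof.
move=> d0 df0; apply/funext => n; rewrite [RHS]coef0.
elim/ltn_ind: n => n IHn.
have /eqP := congr1 (@^~ n) df0; rewrite coef_seriesM big_ord_recl subn0 big1.
  by rewrite addr0 [X in _ == X]coef0 mulf_eq0 (negbTE d0) => /eqP.
by move=> j _; rewrite IHn ?mulr0 //= /bump /= ltn_subrL /=; case: (n) j => [[]|].
Qed.

(** A series with invertible constant coefficient is a regular element, so that
    identities between quotients may be checked after clearing denominators. *)
Lemma series_mulI d f g : d 0%N != 0 -> d * f = d * g -> f = g.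
Proof.
move=> d0 /eqP; rewrite -subr_eq0 -mulrBr => /eqP/(series_mul0_eq0 d0)/eqP.
by rewrite subr_eq0 => /eqP.
Qed.

Lemma coef0_seriesM f g : (f * g) 0%N = f 0%N * g 0%N.
Proof. by rewrite coef_seriesM big_ord1. Qed.

Lemma coef0_series_prod1 I (r : seq I) (P : pred I) (f : I -> series) :
  (forall i, P i -> f i 0%N = 1) -> (\prod_(i <- r | P i) f i) 0%N = 1.
Proof.
move=> f1; elim/big_rec: _ => [|i x Pi x1]; first exact: coef1.
by rewrite coef0_seriesM x1 f1 // mulr1.
Qed.

(** No exponent larger than n contributes to the coefficient of degree n, so
    that the factors may be replaced by polynomials. *)
Lemma coef_series_prod N (f : 'I_N -> series) n :
  (\prod_s f s) n =
  \sum_(c : {ffun 'I_N -> 'I_n.+1} | (\sum_s c s == n)%N) \prod_s f s (c s).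
Proof.
have trunc (r : seq 'I_N) k : (k < n.+1)%N ->
    (\prod_(s <- r) f s) k = (\prod_(s <- r) \poly_(j < n.+1) f s j)`_k.
  elim: r k => [|s r IHr] k lt_kn; first by rewrite !big_nil.
  rewrite !big_cons coefM coef_seriesM; apply: eq_bigr => j _.
  rewrite coef_poly (leq_trans (ltn_ord j)) // IHr //.
  exact: leq_ltn_trans (leq_subr _ _) lt_kn.
rewrite trunc //; under eq_bigr => s _ do rewrite poly_def.
rewrite bigA_distr_bigA coef_sum [RHS]big_mkcond.
apply: eq_bigr => c _; rewrite scaler_prod -expr_sum coefZ coefXn eq_sym.
by case: eqP => _; rewrite ?mulr1 ?mulr0.
Qed.

Lemma taylor_unique (p d : {poly F}) f :
  d`_0 != 0 -> series_of_poly d * f = series_of_poly p -> f = taylor p d.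
Proof.
move=> d0 df; apply: (@series_mulI (series_of_poly d)) => //.
apply/funext => n; rewrite df mulrC coef_seriesM [LHS]/series_of_poly.
by rewrite -(taylorP p n d0); apply: eq_bigr => k _; rewrite mulrC.
Qed.

End PowerSeries.

(** * Partial fractions *)

Section PartialFractions.
Variables (F : fieldType) (I : eqType) (r : F) (a b : I -> F).

(** The factors of [prod_partial_fractions] in the case A = F and
    G(p) = 1 / (1 - p / z). *)
Definition fraction_eval (s : I) (z : F) : F :=
  1 + r * ((1 - a s / z)^-1 - (1 - b s / z)^-1).

Hypotheses (a_neq0 : forall s, a s != 0) (b_neq0 : forall s, b s != 0).

(** The decomposition of a product into partial fractions only uses the formula
    for the product of two polar parts G(x) and G(y) with x != y.  Stated for
    elements G(p) of any ring, it applies to the values at a point as well as to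
    the expansions at infinity and at 0.  The residue at a pole is multiplied by
    the values there of the other factors, which are numbers: the induction
    therefore uses the statement for A and for F at the same time. *)
Lemma prod_partial_fractions (l : seq I) :
  uniq l ->
  {in l &, forall s t, s != t ->
    [&& a s != a t, a s != b t, b s != a t & b s != b t]} ->
  forall (A : comNzRingType) (h : {rmorphism F -> A}) (G : F -> A),
    {in [seq a s | s <- l] ++ [seq b s | s <- l] &, forall x y, x != y ->
       G x * G y = h (1 - y / x)^-1 * G x + h (1 - x / y)^-1 * G y} ->
  \prod_(s <- l) (1 + h r * (G (a s) - G (b s))) =
  1 + \sum_(s <- l)
        (h (r * \prod_(t <- l | t != s) fraction_eval t (a s)) * G (a s) -
         h (r * \prod_(t <- l | t != s) fraction_eval t (b s)) * G (b s)).
Proof.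
elim: l => [|t l IHl] /= => [_ _ A h G _|]; first by rewrite !big_nil addr0.
case/andP => tl ul disj A h G GG.
have disjl : {in l &, forall s t, s != t ->
    [&& a s != a t, a s != b t, b s != a t & b s != b t]}.
  by move=> x y xl yl; apply: disj; rewrite inE ?xl ?yl orbT.
have poleP p : p \in [seq a s | s <- l] ++ [seq b s | s <- l] ->
    [/\ p != 0, p != a t, p != b t
      & p \in a t :: [seq a s | s <- l] ++ b t :: [seq b s | s <- l]].
  move=> pl; have pin : p \in a t :: [seq a s | s <- l] ++ b t :: [seq b s | s <- l].
    by move: pl; rewrite !(inE, mem_cat) => /orP[]->; rewrite ?orbT.
  by move: pl pin; rewrite mem_cat => /orP[]/mapP[s sl ->]; split=> //;
    (have st : s != t by apply: contraNneq tl => <-);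
    have := disj s t; rewrite !inE sl eqxx orbT => /(_ isT isT st)/and4P[].
have atl : a t \in a t :: [seq a s | s <- l] ++ b t :: [seq b s | s <- l].
  by rewrite inE eqxx.
have btl : b t \in a t :: [seq a s | s <- l] ++ b t :: [seq b s | s <- l].
  by rewrite !(inE, mem_cat) eqxx !orbT.
(* The residues at the poles of the new factor are values of the product over l,
   given by the induction hypothesis for A = F. *)
have evalE z : z \notin [seq a s | s <- l] ++ [seq b s | s <- l] -> z != 0 ->
    \prod_(s <- l) fraction_eval s z = 1 + \sum_(s <- l)
      (r * \prod_(t <- l | t != s) fraction_eval t (a s) / (1 - a s / z) -
       r * \prod_(t <- l | t != s) fraction_eval t (b s) / (1 - b s / z)).
  move=> zl z0; have := IHl _ disjl F idfun (fun p => (1 - p / z)^-1).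
  apply=> // x y xl yl xy /=.
  have [x0 _ _ _] := poleP _ xl; have [y0 _ _ _] := poleP _ yl.
  have zx : z != x by apply: contraNneq zl => ->.
  have zy : z != y by apply: contraNneq zl => ->.
  by field; rewrite !subr_eq0 z0 x0 y0 zx zy xy eq_sym xy.
(* Multiplication by the new factor scales the polar part at p by the value of
   that factor at p, and creates polar parts at a_t and b_t. *)
have step p c : p \in [seq a s | s <- l] ++ [seq b s | s <- l] ->
    (1 + h r * (G (a t) - G (b t))) * (h (r * c) * G p) =
    h (r * (fraction_eval t p * c)) * G p
    + h r * (h (r * c / (1 - p / a t)) * G (a t)
             - h (r * c / (1 - p / b t)) * G (b t)).
  move=> /poleP[p0 pa pb pl]; rewrite mulrDl mul1r -mulrA mulrBl.
  rewrite ![G _ * (_ * G p)]mulrCA !GG ?(eq_sym _ p) //.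
  rewrite /fraction_eval !(rmorphM, rmorphD, rmorphB, rmorph1) /=.
  ring.
have atF : a t \notin [seq a s | s <- l] ++ [seq b s | s <- l].
  by apply/negP => /poleP[_ /eqP].
have btF : b t \notin [seq a s | s <- l] ++ [seq b s | s <- l].
  by apply/negP => /poleP[_ _ /eqP].
have neq_t s : s \in l -> (s != t) = true.
  by move=> sl; apply: contraNneq tl => <-.
have residue_t z : \prod_(s <- t :: l | s != t) fraction_eval s z =
    \prod_(s <- l) fraction_eval s z.
  rewrite big_cons eqxx /= big_seq_cond [RHS]big_seq; apply: eq_bigl => s /=.
  by case: (boolP (s \in l)) => //= /neq_t.
have residue_l s z : s \in l -> \prod_(u <- t :: l | u != s) fraction_eval u z =
    fraction_eval t z * \prod_(u <- l | u != s) fraction_eval u z.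
  by move=> /neq_t ts; rewrite big_cons eq_sym ts.
rewrite [LHS]big_cons [X in _ = 1 + X]big_cons !residue_t !evalE //.
rewrite (eq_big_seq _ (fun s sl => congr2 (fun x y => h (r * x) * _ - h (r * y) * _)
  (residue_l s (a s) sl) (residue_l s (b s) sl))).
rewrite IHl //; last first.
  move=> x y /poleP[_ _ _ xl] /poleP[_ _ _ yl]; exact: GG.
rewrite mulrDr mulr1 mulr_sumr.
set res := fun s z => \prod_(u <- l | u != s) fraction_eval u z.
rewrite -/(res _ _) in residue_l *.
pose W z := \sum_(s <- l)
  (r * res s (a s) / (1 - a s / z) - r * res s (b s) / (1 - b s / z)).
rewrite -/(W (a t)) -/(W (b t)).
have -> : \sum_(s <- l) (1 + h r * (G (a t) - G (b t))) *
      (h (r * res s (a s)) * G (a s) - h (r * res s (b s)) * G (b s)) =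
    \sum_(s <- l) (h (r * (fraction_eval t (a s) * res s (a s))) * G (a s) -
      h (r * (fraction_eval t (b s) * res s (b s))) * G (b s)) +
    h r * (h (W (a t)) * G (a t) - h (W (b t)) * G (b t)).
  rewrite /W !rmorph_sum !mulr_suml -sumrB mulr_sumr -big_split.
  apply: eq_big_seq => s sl /=; rewrite mulrBr !step ?mem_cat ?map_f ?orbT //.
  rewrite !rmorphB /=; ring.
rewrite !(rmorphM, rmorphD, rmorph1) /=; ring.
Qed.

End PartialFractions.

(** * The two expansions of gamma *)

Section Expansions.
Variable F : fieldType.
Implicit Types (b : bool) (p x y : F).

Definition const_series : F -> series F := @series_of_poly F \o polyC.
HB.instance Definition _ := GRing.RMorphism.on const_series.

(** The expansions at infinity (b = true) and at 0 (b = false) are power series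
    in 1/z and in z.  In terms of that variable, [one_minus b p] is 1 - p / z
    times [expansion_unit b], which is 1 in the first case and z in the second. *)
Definition one_minus b p : {poly F} := if b then 1 - p *: 'X else 'X - p%:P.
Definition expansion_unit b : {poly F} := if b then 1 else 'X.

(** The expansion of 1 / (1 - p / z). *)
Definition geometric b p : series F :=
  fun n => if b then p ^+ n else (n == 0%N)%:R - p ^- n.

Lemma one_minus_coef0 b p : p != 0 -> (one_minus b p)`_0 != 0.
Proof.
rewrite /one_minus; case: b => p0.
  by rewrite coefB coef1 coefZ coefX mulr0 subr0 oner_neq0.
by rewrite coefB coefX coefC sub0r oppr_eq0.
Qed.

Lemma one_minus_geometric b p : p != 0 ->
  series_of_poly (one_minus b p) * geometric b p =
  series_of_poly (expansion_unit b).
Proof.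
move=> p0; apply/funext => n; rewrite /one_minus /geometric; case: b.
  rewrite rmorphB mulrBl rmorph1 mul1r -mul_polyC rmorphM -mulrA.
  rewrite coef_seriesB coef_seriesCM coef_seriesXM /=.
  case: n => [|n]; first by rewrite mulr0 subr0 expr0 [RHS]coef1.
  by rewrite exprS subrr [RHS]coef1.
rewrite rmorphB mulrBl coef_seriesB coef_seriesCM coef_seriesXM /=.
rewrite /series_of_poly coefX; case: n => [|n].
  by rewrite invr1 subrr mulr0 subr0.
case: n => [|n]; rewrite /= ?sub0r ?mulrN ?opprK.
  by rewrite invr1 subrr add0r expr1 divff.
by rewrite [p ^+ n.+2]exprS invfM mulrA divff // mul1r addNr.
Qed.

(** Both expansions satisfy the hypothesis of [prod_partial_fractions], by an
    identity between polynomials once the denominators are cleared. *)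
Lemma geometric_mul b x y : x != 0 -> y != 0 -> x != y ->
  geometric b x * geometric b y =
  const_series (1 - y / x)^-1 * geometric b x +
  const_series (1 - x / y)^-1 * geometric b y.
Proof.
move=> x0 y0 xy.
apply: (@series_mulI _ (series_of_poly (one_minus b x * one_minus b y))).
  by rewrite /series_of_poly coef0M mulf_neq0 ?one_minus_coef0.
have key : (expansion_unit b) ^+ 2 =
    (1 - y / x)^-1%:P * one_minus b y * expansion_unit b +
    (1 - x / y)^-1%:P * one_minus b x * expansion_unit b.
  have -> : (1 - y / x)^-1 = x / (x - y) by field; rewrite subr_eq0 x0 xy.
  have -> : (1 - x / y)^-1 = - (y / (x - y)).
    by field; rewrite !subr_eq0 y0 xy eq_sym xy.
  have xy1 : (x / (x - y))%:P = (y / (x - y))%:P + 1 :> {poly F}.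
    by rewrite -polyC1 -polyCD; congr (_%:P); field; rewrite subr_eq0.
  have xy2 : (x / (x - y))%:P * y%:P = (y / (x - y))%:P * x%:P :> {poly F}.
    by rewrite -!polyCM; congr (_%:P); field; rewrite subr_eq0.
  rewrite xy1 mulrDl mul1r in xy2; rewrite polyCN xy1 /expansion_unit /one_minus.
  move: (y / _)%:P (esym xy2) => k kx.
  by case: b; rewrite -?[_ *: 'X]mul_polyC -?[x *: 'X]mul_polyC; ring: kx.
have := congr1 (@series_of_poly F) key.
rewrite !(rmorphXn, rmorphD, rmorphM) /= => skey.
have gx := one_minus_geometric b x0; have gy := one_minus_geometric b y0.
rewrite /const_series /=.
ring: gx gy skey.
Qed.

End Expansions.
Arguments expansion_unit {F}.

Section GammaSeries.
Variables (F : fieldType) (q1 q2 q3 : F).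
Hypotheses (q1_neq0 : q1 != 0) (q1_neq1 : q1 != 1) (q123 : q1 * q2 * q3 = 1).
Implicit Types (b : bool) (x y u : F).

(** The coefficient of 1 / (1 - x / z) in gamma; as gamma takes the value 1 at 0
    and at infinity, that of 1 / (1 - x / (q1 z)) is the opposite. *)
Definition residue : F := (1 - q2) * (1 - q3) / (1 - q1^-1).

(** The value at y of the function gamma of a factor at the point x = q1^i u. *)
Definition gamma_at x y : F :=
  (y - q3 * x) * (y - q2 * x) / ((y - x / q1) * (y - x)).

Definition gamma_series b x : series F :=
  1 + const_series residue * (geometric b x - geometric b (x / q1)).

Local Notation S := (@series_of_poly F).

Let q2_neq0 : q2 != 0 := factor2_neq0 q123.
Let q3_neq0 : q3 != 0 := factor3_neq0 q123.
Let q1V : q1^-1 = q2 * q3.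
Proof. by apply: (mulfI q1_neq0); rewrite mulrA q123 divff. Qed.
Let q3E : q3 = (q1 * q2)^-1 := factor3E q123.
Let x_divq1 x : x != 0 -> x / q1 != 0.
Proof. by move=> x0; rewrite mulf_neq0 ?invr_neq0. Qed.
Let q1V_neq1 : 1 - q1^-1 != 0.
Proof. by rewrite subr_eq0 eq_sym invr_eq1. Qed.

Lemma gamma_seriesP b x : x != 0 ->
  S (one_minus b x * one_minus b (x / q1)) * gamma_series b x =
  S (one_minus b (q2 * x) * one_minus b (q3 * x)).
Proof.
move=> x0; have gx := one_minus_geometric b x0.
have gy := one_minus_geometric b (x_divq1 x0).
have c_def : residue%:P * (1 - q1^-1)%:P = (1 - q2)%:P * (1 - q3)%:P :> {poly F}.
  by rewrite -!polyCM divfK.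
have key : one_minus b x * one_minus b (x / q1) + residue%:P * expansion_unit b *
    (one_minus b (x / q1) - one_minus b x) =
    one_minus b (q2 * x) * one_minus b (q3 * x).
  rewrite /expansion_unit /one_minus q1V in c_def *.
  case: b {gx gy}; rewrite -?[_ *: 'X]mul_polyC.
    transitivity ((1 - x%:P * 'X) * (1 - (x * (q2 * q3))%:P * 'X) +
        (residue%:P * (1 - q2 * q3)%:P) * (x%:P * 'X)); first by ring.
    by rewrite c_def; ring.
  transitivity (('X - x%:P) * ('X - (x * (q2 * q3))%:P) +
      (residue%:P * (1 - q2 * q3)%:P) * (x%:P * 'X)); first by ring.
  by rewrite c_def; ring.
have := congr1 S key; rewrite /gamma_series /const_series /=.
rewrite !(rmorphB, rmorphD, rmorphM) /= => <-.
ring: gx gy.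
Qed.

Lemma coef0_gamma_series b x : gamma_series b x 0%N = 1.
Proof.
rewrite /gamma_series coef_seriesD coef_seriesCM coef_seriesB coef_series1 /geometric.
by case: b; rewrite ?expr0 ?invr1 subrr mulr0 addr0.
Qed.

Lemma gamma_coefE b i u k : u != 0 ->
  gamma_coef q1 q2 q3 b i u k = gamma_series b (q1 ^ i * u) k.
Proof.
move=> u0; set x := q1 ^ i * u.
have x0 : x != 0 by rewrite mulf_neq0 ?expfz_neq0.
have iE : q1 ^ (i - 1) * u = x / q1 by rewrite expfzDr // mulrAC.
have rev2_lin (c d : F) :
    rev2 ((1 - c *: 'X) * (1 - d *: 'X)) = ('X - c%:P) * ('X - d%:P).
  apply/polyP => n; rewrite coef_poly.
  have -> : (1 - c *: 'X) * (1 - d *: 'X) =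
      1 - (c + d) *: 'X + (c * d) *: 'X^2 :> {poly F}.
    by rewrite -!mul_polyC polyCD polyCM; ring.
  have -> : ('X - c%:P) * ('X - d%:P) =
      'X^2 - (c + d) *: 'X + (c * d)%:P :> {poly F}.
    by rewrite -!mul_polyC polyCD polyCM; ring.
  rewrite !(coefD, coefN, coefZ, coefX, coefXn, coef1, coefC).
  by case: n => [|[|[|n]]] /=;
    rewrite ?mulr0 ?mulr1 ?add0r ?addr0 ?subr0 ?oppr0 ?addr0.
have lin_coef0 (c d : F) : c != 0 -> d != 0 ->
    (one_minus b c * one_minus b d)`_0 != 0.
  by move=> c0 d0; rewrite coef0M mulf_neq0 ?one_minus_coef0.
have d0 := lin_coef0 _ _ (x_divq1 x0) x0.
rewrite /gamma_coef /gamma_num /gamma_den iE.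
have gE := gamma_seriesP b x0.
rewrite [X in S X * _]mulrC [X in _ = S X]mulrC in gE.
rewrite (taylor_unique d0 gE) /one_minus -!mulrA -/x.
by case: b {gE d0 lin_coef0}; rewrite ?rev2_lin.
Qed.

(** Moving the point of a factor from x to q1 x multiplies gamma by
    - g(x, z) / g(z, x), the quotient of the products of the 1 - x / (q_j z) and
    of the 1 - q_j x / z. *)
Lemma gamma_series_shift b x : x != 0 ->
  S (one_minus b (q1 * x) * (one_minus b (q2 * x) * one_minus b (q3 * x))) *
    gamma_series b (q1 * x) =
  S (one_minus b (x / q1) * (one_minus b (x / q2) * one_minus b (x / q3))) *
    gamma_series b x.
Proof.
move=> x0; have qx0 : q1 * x != 0 by rewrite mulf_neq0.
apply: (@series_mulI _ (S (one_minus b x * one_minus b (x / q1)))).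
  by rewrite /series_of_poly coef0M mulf_neq0 ?one_minus_coef0 ?x_divq1.
have gx := gamma_seriesP b x0; have gqx := gamma_seriesP b qx0.
have e3 : q3 * (q1 * x) = x / q2 by rewrite -[RHS]mul1r -q123; field.
have e2 : q2 * (q1 * x) = x / q3 by rewrite -[RHS]mul1r -q123; field.
rewrite e2 e3 mulrAC divff // mul1r !rmorphM /= in gx gqx *.
transitivity (S (one_minus b (q2 * x)) * S (one_minus b (q3 * x)) *
  S (one_minus b (x / q1)) * (S (one_minus b (q1 * x)) * S (one_minus b x) *
   gamma_series b (q1 * x))); first by ring.
rewrite gqx -gx; ring.
Qed.

Lemma gamma_atE i u z : u != 0 -> z != 0 ->
  gamma q1 q2 q3 i u z = gamma_at (q1 ^ i * u) z.
Proof.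
move=> u0 z0; rewrite /gamma /gamma_at /gamma_num /gamma_den.
rewrite expfzDr // exprN1 -[q3 * _ * u]mulrA -[q2 * _ * u]mulrA mulrAC.
set x := q1 ^ i * u.
rewrite !hornerE.
have lin c d : (1 - c / z) * (1 - d / z) = (z - c) * (z - d) / (z * z) by field.
by rewrite !lin invf_div mulrA divfK ?mulf_neq0.
Qed.

Lemma gamma_at_fraction_eval (I : eqType) (a : I -> F) s z :
  z != 0 -> a s != z -> a s / q1 != z ->
  fraction_eval residue a (fun s => a s / q1) s z = gamma_at (a s) z.
Proof.
move=> z0 az aqz; rewrite /fraction_eval /gamma_at /residue.
move: (a s) az aqz => x xz xqz.
have n0 : z - x != 0 by rewrite subr_eq0 eq_sym.
have n1 : z * q1 - x != 0.
  by apply: contraNneq xqz => /eqP; rewrite subr_eq0 => /eqP <-; rewrite mulfK.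
have n2 : q1 - 1 != 0 by rewrite subr_eq0.
rewrite q3E.
by field; rewrite q1_neq0 n0 n1 q2_neq0 z0 n2.
Qed.

(** As q1 q2 q3 = 1, the zeros of the left side, at y = q1 q2 x and q1 q3 x, are
    x / q3 and x / q2, the zeros of the right side; the poles are x and q1 x on
    both sides. *)
Lemma gamma_at_shift x y : gamma_at (q1 * x) y = gamma_at y x.
Proof.
rewrite /gamma_at.
have -> : (y - q3 * (q1 * x)) * (y - q2 * (q1 * x)) =
    q1 * ((x - q3 * y) * (x - q2 * y)).
  by rewrite q3E; field; rewrite q1_neq0 q2_neq0.
have -> : (y - q1 * x / q1) * (y - q1 * x) = q1 * ((x - y / q1) * (x - y)).
  by field.
by rewrite -mulf_div divff // mul1r.
Qed.

End GammaSeries.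

(** * Actions of an algebra given by generators and relations *)

Section Evaluation.
Variables (F : fieldType) (X : Type) (V : lmodType F) (rho : X -> V -> V).

Fixpoint eval_expr (x : expr F X) : V -> V :=
  match x with
  | Gen g => rho g
  | Const c => fun v => c *: v
  | Add x y => fun v => eval_expr x v + eval_expr y v
  | Mul x y => fun v => eval_expr x (eval_expr y v)
  end.

Lemma eval_exprN x v : eval_expr (- x)%X v = - eval_expr x v.
Proof. exact: scaleN1r. Qed.

Hypothesis rho_linear : forall g, linear (rho g).

Lemma eval_expr_linear x : linear (eval_expr x).
Proof.
elim: x => [g|d|x IHx y IHy|x IHx y IHy] c v w //=.
- exact: rho_linear.
- by rewrite scalerDr !scalerA mulrC.
- by rewrite IHx IHy scalerDr addrACA.
- by rewrite IHy IHx.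
Qed.

Lemma eval_expr_eq (rel : expr F X -> expr F X -> Prop) :
  (forall x y, rel x y -> eval_expr x =1 eval_expr y) ->
  forall x y, expr_eq rel x y -> eval_expr x =1 eval_expr y.
Proof.
move=> relE x y; elim=> {x y} //=.
- by move=> x y _ xy v; rewrite xy.
- by move=> x y z _ xy _ yz v; rewrite xy.
- by move=> x x' y y' _ xx' _ yy' v /=; rewrite xx' yy'.
- by move=> x x' y y' _ xx' _ yy' v /=; rewrite xx' yy'.
- by move=> x y z v /=; rewrite addrA.
- by move=> x y v /=; rewrite addrC.
- by move=> x v /=; rewrite scale0r add0r.
- by move=> x v /=; rewrite scale1r.
- by move=> x v /=; rewrite !scale0r.
- move=> x y z v /=; have := eval_expr_linear x 1 (eval_expr y v) (eval_expr z v).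
  by rewrite !scale1r.
- move=> c x v /=; have := eval_expr_linear x c v 0; rewrite !addr0 => ->.
  have := eval_expr_linear x (-1) 0 0; rewrite scaler0 addr0 scaleN1r addNr => ->.
  by rewrite addr0.
- by move=> c d v /=; rewrite scalerDl.
- by move=> c d v /=; rewrite scalerA.
Qed.

End Evaluation.

Section EModules.
Variables (F : fieldType) (q1 q2 q3 : F) (V : lmodType F).
Local Notation pi := (presalg_pi (Erel q1 q2 q3)).

(** The universal property of the presentation: an element acts through any
    expression that represents it. *)
Lemma Ealg_action_exists (rho : Egen -> V -> V) :
  (forall g, linear (rho g)) ->
  (forall x y, Erel q1 q2 q3 x y -> eval_expr rho x =1 eval_expr rho y) ->
  exists2 act : Ealg q1 q2 q3 -> V -> V, algebra_action act &
    forall g v, act (pi (Gen g)) v = rho g v.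
Proof.
move=> rho_lin rho_rel.
have ev_eq := eval_expr_eq rho_lin rho_rel.
pose act (a : Ealg q1 q2 q3) := eval_expr rho (presalg_repr a).
have actE x v : act (pi x) v = eval_expr rho x v.
  exact/ev_eq/presalg_repr_pi.
exists act; last by move=> g v; exact: actE.
split=> [a|v c a b|v|a b v].
- exact: eval_expr_linear.
- elim/presalg_ind: a => a; elim/presalg_ind: b => b.
  by rewrite -[_ *: _]/(presalg_scale c (pi a)) presalg_scaleE -presalg_piD !actE.
- by rewrite -[1]/(pi (Const 1)) actE /= scale1r.
- elim/presalg_ind: a => a; elim/presalg_ind: b => b.
  by rewrite -presalg_piM !actE.
Qed.

Lemma algebra_action_ext (act act' : Ealg q1 q2 q3 -> V -> V) :
  algebra_action act -> algebra_action act' ->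
  (forall g v, act (pi (Gen g)) v = act' (pi (Gen g)) v) -> act = act'.
Proof.
move=> actP actP' eq_gen; apply/funext => a; apply/funext => v.
elim/presalg_ind: a => x; elim: x v => [g|c|x IHx y IHy|x IHx y IHy] v //.
- have constE f : algebra_action f -> f (pi (Const c) : Ealg q1 q2 q3) v = c *: v.
    move=> fP; have f0 : f 0 v = 0.
      by have := action_linearl fP v (-1) 0 0; rewrite scaler0 addr0 scaleN1r addNr.
    have -> : pi (Const c) = c *: (1 : Ealg q1 q2 q3) + 0.
      by rewrite addr0; exact: presalg_piC.
    by rewrite (action_linearl fP) f0 addr0 (action1 fP).
  by rewrite !constE.
- have addE f : algebra_action f ->
      f (pi (x + y)%X : Ealg q1 q2 q3) v = f (pi x) v + f (pi y) v.
    move=> fP; have := action_linearl fP v 1 (pi x) (pi y).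
    by rewrite !scale1r => <-; rewrite presalg_piD.
  by rewrite !addE // IHx IHy.
- by rewrite presalg_piM (actionM actP) (actionM actP') IHy IHx.
Qed.

End EModules.

(** * Linear maps on free modules *)

Section LinearExtension.
Variables (F : fieldType) (K : choiceType).
Local Notation M := {malg F[K]}.

Definition linear_extension (V : lmodType F) (B : K -> V) (v : M) : V :=
  \sum_(k <- msupp v) v@_k *: B k.

Lemma linear_extension_linear (V : lmodType F) (B : K -> V) :
  linear (linear_extension B).
Proof.
have widen (d : {fset K}) v : (msupp v `<=` d)%fset ->
    linear_extension B v = \sum_(k <- d) v@_k *: B k.
  move=> vd; rewrite /linear_extension; apply: big_fset_incl => // k _ kv.
  by rewrite mcoeff_outdom // scale0r.
move=> c v w; pose d := (msupp v `|` msupp w)%fset.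
rewrite (widen d) ?(widen d v) ?(widen d w) ?fsubsetUl ?fsubsetUr //.
  rewrite scaler_sumr -big_split; apply: eq_bigr => k _ /=.
  by rewrite mcoeffD mcoeffZ scalerDl scalerA.
apply: fsubset_trans (msuppD_le _ _) _.
by rewrite fsetSU // msuppZ_le.
Qed.

Lemma linear_extensionU (V : lmodType F) (B : K -> V) k :
  linear_extension B << k >> = B k.
Proof.
by rewrite /linear_extension msuppU oner_eq0 big_seq_fset1 mcoeffUU scale1r.
Qed.

Lemma linear_comb (V W : lmodType F) (f : V -> W) : linear f ->
  forall I (r : seq I) (P : pred I) (c : I -> F) (v : I -> V),
  f (\sum_(i <- r | P i) c i *: v i) = \sum_(i <- r | P i) c i *: f (v i).
Proof.
move=> flin I r P c v.
have f0 : f 0 = 0.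
  by have := flin (-1) 0 0; rewrite scaler0 addr0 scaleN1r addNr.
elim: r => [|i r IHr]; first by rewrite !big_nil.
by rewrite !big_cons; case: (P i); rewrite // flin IHr.
Qed.

Lemma linear_malg_ext (V : lmodType F) (f h : M -> V) :
  linear f -> linear h -> (forall k, f << k >> = h << k >>) -> f =1 h.
Proof.
move=> flin hlin fh v; rewrite [v]monalgE.
have UE k : << v@_k *g k >> = v@_k *: << k >> :> M.
  by apply/malgP => j; rewrite mcoeffZ !mcoeffU mulrnAr mulr1.
under eq_bigr => k _ do rewrite UE.
by rewrite !linear_comb //; apply: eq_bigr => k _; rewrite fh.
Qed.

End LinearExtension.

(** The generators inverting psi_0 act by the inverses of the operators psi_0, so
    that an action is determined by the other generators. *)
Lemma Ealg_action_basis_ext (F : fieldType) (q1 q2 q3 : F) (K : choiceType)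
    (act act' : Ealg q1 q2 q3 -> {malg F[K]} -> {malg F[K]}) :
  algebra_action act -> algebra_action act' ->
  (forall n k, act (Ee q1 q2 q3 n) << k >> = act' (Ee q1 q2 q3 n) << k >>) ->
  (forall n k, act (Ef q1 q2 q3 n) << k >> = act' (Ef q1 q2 q3 n) << k >>) ->
  (forall b n k, act (Epsi q1 q2 q3 b n) << k >> = act' (Epsi q1 q2 q3 b n) << k >>) ->
  act = act'.
Proof.
move=> actP actP' e_eq f_eq psi_eq.
have ext a : (forall k, act a << k >> = act' a << k >>) -> act a =1 act' a.
  by apply: linear_malg_ext; exact: action_linearr.
apply: algebra_action_ext => //; case=> [n|n|b n|b] v.
- exact: (ext (Ee q1 q2 q3 n)).
- exact: (ext (Ef q1 q2 q3 n)).
- exact: (ext (Epsi q1 q2 q3 b n)).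
pose P : Ealg q1 q2 q3 := Epsi q1 q2 q3 b 0.
pose W : Ealg q1 q2 q3 := presalg_pi (Erel q1 q2 q3) (Gen (GpsiV b)).
have PW : P * W = 1 :> Ealg q1 q2 q3.
  apply: etrans (esym (presalg_piM _ _ _)) _.
  exact/presalg_eqP/EqRel/Erel_psiV.
have WP : W * P = 1 :> Ealg q1 q2 q3.
  apply: etrans (esym (presalg_piM _ _ _)) _.
  exact/presalg_eqP/EqRel/Erel_Vpsi.
rewrite -/W -[v in LHS](action1 actP') -PW (actionM actP') -(ext P (psi_eq b 0%N)).
by rewrite -(actionM actP) WP (action1 actP).
Qed.

(** * Series with delta-function coefficients *)

Section DeltaSeries.
Variables (F : fieldType) (q1 q2 q3 : F) (V : lmodType F) (rho : Egen -> V -> V).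
Variables (J : finType) (y : J -> F) (w : J -> V) (v : V).
Hypothesis y_neq0 : forall j, y j != 0.
Implicit Types (s : int -> int -> expr F Egen).

(** The series (z - q y) phi(z) and (y - q z) phi(z), where phi m is the
    coefficient of z^-m in phi(z). *)
Definition mul_zBq (q y0 : F) (phi : int -> F) : int -> F :=
  fun m => phi (m + 1) - q * y0 * phi m.
Definition mul_Bqz (q y0 : F) (phi : int -> F) : int -> F :=
  fun m => y0 * phi m - q * phi (m + 1).

(** The series s(z, w) v is the sum over j of the phi_j(z) delta(y_j / w) w_j.
    On such a sum, multiplication by a polynomial in z and w replaces w by y_j,
    so that only series in one variable remain. *)
Definition delta_sum (phi : J -> int -> F) s : Prop :=
  forall m n, eval_expr rho (s m n) v = \sum_j (phi j m * y j ^ n) *: w j.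

Lemma delta_sum_zBqw q phi s : delta_sum phi s ->
  delta_sum (fun j => mul_zBq q (y j) (phi j)) (mul_zBqw q s).
Proof.
move=> sP m n; rewrite /= !sP scaleN1r scaler_sumr -sumrB.
apply: eq_bigr => j _; rewrite /mul_zBq expfzDr // expr1z scalerA -scalerBl.
by congr (_ *: _); ring.
Qed.

Lemma delta_sum_wBqz q phi s : delta_sum phi s ->
  delta_sum (fun j => mul_Bqz q (y j) (phi j)) (mul_wBqz q s).
Proof.
move=> sP m n; rewrite /= !sP scaleN1r scaler_sumr -sumrB.
apply: eq_bigr => j _; rewrite /mul_Bqz expfzDr // expr1z scalerA -scalerBl.
by congr (_ *: _); ring.
Qed.

(** The series g(z, y) phi(z) and g(y, z) phi(z). *)
Definition g_left (y0 : F) (phi : int -> F) : int -> F :=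
  mul_zBq q1 y0 (mul_zBq q2 y0 (mul_zBq q3 y0 phi)).
Definition g_right (y0 : F) (phi : int -> F) : int -> F :=
  mul_Bqz q1 y0 (mul_Bqz q2 y0 (mul_Bqz q3 y0 phi)).

Lemma delta_sum_gzw phi s : delta_sum phi s ->
  delta_sum (fun j => g_left (y j) (phi j)) (mul_gzw q1 q2 q3 s).
Proof. by move=> sP; do 3!apply: delta_sum_zBqw. Qed.

Lemma delta_sum_gwz phi s : delta_sum phi s ->
  delta_sum (fun j => g_right (y j) (phi j)) (mul_gwz q1 q2 q3 s).
Proof. by move=> sP; do 3!apply: delta_sum_wBqz. Qed.

Lemma g_left_exp (x y0 : F) m : x != 0 ->
  g_left y0 (fun m => x ^ m) m = g q1 q2 q3 x y0 * x ^ m.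
Proof.
move=> x0; rewrite /g_left /mul_zBq /g !expfzDr // !expr1z; ring.
Qed.

Lemma g_right_exp (x y0 : F) m : x != 0 ->
  g_right y0 (fun m => x ^ m) m = g q1 q2 q3 y0 x * x ^ m.
Proof.
move=> x0; rewrite /g_right /mul_Bqz /g !expfzDr // !expr1z; ring.
Qed.

End DeltaSeries.

(** * Exchange identities for gamma *)

Section GammaIdentities.
Variables (F : fieldType) (q1 q2 q3 : F).
Hypotheses (q1_neq0 : q1 != 0) (q123 : q1 * q2 * q3 = 1).
Implicit Types x y z : F.

Local Notation gamma_at := (gamma_at q1 q2 q3).
Local Notation g := (g q1 q2 q3).

Let q2_neq0 : q2 != 0 := factor2_neq0 q123.
Let q3E : q3 = (q1 * q2)^-1 := factor3E q123.

Definition apart x y : bool := [&& y != x, y != q1 * x & x != q1 * y].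

Lemma apart_sym x y : apart x y = apart y x.
Proof. by rewrite /apart eq_sym; congr (_ && _); rewrite andbC. Qed.

Definition exchange_den x y : F := (y - x / q1) * (y - x) * (y - q1 * x).

Lemma exchange_denC x y : exchange_den y x = - exchange_den x y.
Proof. by rewrite /exchange_den; field. Qed.

(** Over this antisymmetric denominator the numerators are values of g; the
    factors y - q1 x cancel. *)
Lemma gamma_at_exchange x y : apart x y ->
  gamma_at x y = g y x / exchange_den x y.
Proof.
case/and3P => xy qxy xqy; rewrite /gamma_at /g /exchange_den.
have n1 : y - q1 * x != 0 by rewrite subr_eq0.
have n2 : y - x != 0 by rewrite subr_eq0.
have n3 : y * q1 - x != 0 by rewrite subr_eq0 mulrC eq_sym.
by field; rewrite q1_neq0 n1 n2 n3.
Qed.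

(** The operator [e_0, [e_1, e_-1]] is a combination of products e_i e_j e_k,
    which give z1^i z2^j z3^k if the rightmost operator moves the point z3 and
    the leftmost one the point z1. *)
Definition serre_kernel z1 z2 z3 : F := z2 / z3 - z3 / z2 - z1 / z2 + z2 / z1.

Let gE z w : g z w = z ^+ 3 - (q1 + q2 + q3) * z ^+ 2 * w
  + (q1 * q2 + q1 * q3 + q2 * q3) * z * w ^+ 2 - w ^+ 3.
Proof.
by rewrite -[w ^+ 3 in RHS]mul1r -[1]q123 /g; ring.
Qed.

Lemma gamma_at_antisym x y : apart x y ->
  g y x * gamma_at y x = - (g x y * gamma_at x y).
Proof.
move=> xy; rewrite (gamma_at_exchange xy) gamma_at_exchange 1?apart_sym //.
by rewrite exchange_denC invrN; ring.
Qed.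

(** The common antisymmetric denominators turn the sum over the orders of the
    three moves into an alternating sum of polynomials, which is zero for every
    value of the elementary symmetric functions of q1, q2 and q3 other than
    their product. *)
Lemma serre_distinct x y z :
  x != 0 -> y != 0 -> z != 0 -> apart x y -> apart x z -> apart y z ->
  let h z1 z2 z3 := gamma_at z2 z3 * gamma_at z1 z3 * gamma_at z1 z2 *
                    serre_kernel z1 z2 z3 in
  h x y z + h x z y + h y x z + h y z x + h z x y + h z y x = 0.
Proof.
move=> x0 y0 z0 xy xz yz /=.
rewrite (gamma_at_exchange xy) (gamma_at_exchange xz) (gamma_at_exchange yz).
rewrite !(@gamma_at_exchange y x, @gamma_at_exchange z x, @gamma_at_exchange z y)
  1?apart_sym //.
rewrite (exchange_denC x y) (exchange_denC x z) (exchange_denC y z) !invrN !gE.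
move: (_ x y)^-1 (_ x z)^-1 (_ y z)^-1 => kxy kxz kyz.
move: (q1 + q2 + q3) (q1 * q2 + q1 * q3 + q2 * q3) => e1 e2.
by rewrite /serre_kernel; field; rewrite x0 y0 z0.
Qed.

(** One factor moves twice, from x to q1 x and further, in this order: three of
    the six orders remain. *)
Lemma serre_double x y :
  x != 0 -> y != 0 -> apart x y -> y != q1 ^+ 2 * x ->
  gamma_at y (q1 * x) * serre_kernel y (q1 * x) x +
  gamma_at y x * serre_kernel (q1 * x) y x +
  gamma_at x y * serre_kernel (q1 * x) x y = 0.
Proof.
move=> x0 y0 /and3P[yx yqx xqy] yqqx.
rewrite /gamma_at /serre_kernel q3E.
have yqx' : q1 * x != y by rewrite eq_sym.
have yqqx' : q1 * (q1 * x) != y by rewrite mulrA -expr2 eq_sym.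
have xqy' : q1 * y != x by rewrite eq_sym.
field; rewrite x0 q1_neq0 y0 q2_neq0 !subr_eq0 !(mulrC _ q1) /=.
by rewrite yx xqy' yqx' yqqx' eq_sym yx.
Qed.

Lemma serre_triple x : x != 0 -> serre_kernel (q1 ^+ 2 * x) (q1 * x) x = 0.
Proof. by move=> x0; rewrite /serre_kernel; field; rewrite q1_neq0 x0. Qed.

End GammaIdentities.

(** Inverting the parameters exchanges the zeros q2 x and q3 x, and the poles x
    and x / q1, of gamma, if its point is moved from x to x / q1. *)
Lemma gamma_at_dual (F : fieldType) (q1 q2 q3 x y : F) : q1 * q2 * q3 = 1 ->
  gamma_at q1^-1 q2^-1 q3^-1 (x / q1) y = gamma_at q1 q2 q3 x y.
Proof.
move=> q123; rewrite /gamma_at invrK divfK ?(factor1_neq0 q123) //.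
have q1_neq0 := factor1_neq0 q123; have q2_neq0 := factor2_neq0 q123.
have -> : q3^-1 * (x / q1) = q2 * x by rewrite (factor3E q123) invrK; field.
have -> : q2^-1 * (x / q1) = q3 * x by rewrite (factor3E q123) invfM; ring.
by rewrite [X in X / _]mulrC [X in _ / X]mulrC.
Qed.

(** * Currents *)

Section SymmetricSums.
Variables (F : numFieldType) (V : lmodType F) (I : finType).

Lemma double_sum_eq0 (H : I -> I -> V) :
  (forall s t, H s t + H t s = 0) -> \sum_s \sum_t H s t = 0.
Proof.
move=> H0; apply: (@scalerI _ _ (2%:R : F)); first by rewrite pnatr_eq0.
rewrite scaler0 scaler_nat mulr2n {2}exchange_big -big_split big1 // => s _.
by rewrite -big_split big1 // => t _; exact: H0.
Qed.

Lemma triple_sum_eq0 (H : I -> I -> I -> V) :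
  (forall s t r, H s t r + H s r t + H t s r + H t r s + H r s t + H r t s = 0) ->
  \sum_s \sum_t \sum_r H s t r = 0.
Proof.
move=> H0; set T := \sum_s _.
have swap23 (K : I -> I -> I -> V) :
    \sum_s \sum_t \sum_r K s t r = \sum_s \sum_t \sum_r K s r t.
  by apply: eq_bigr => s _; exact: exchange_big.
have swap12 (K : I -> I -> I -> V) :
    \sum_s \sum_t \sum_r K s t r = \sum_s \sum_t \sum_r K t s r.
  exact: exchange_big.
have e1 : T = \sum_s \sum_t \sum_r H s r t by exact: swap23.
have e2 : T = \sum_s \sum_t \sum_r H t s r by exact: swap12.
have e3 : T = \sum_s \sum_t \sum_r H t r s by rewrite e1 swap12.
have e4 : T = \sum_s \sum_t \sum_r H r s t by rewrite e2 swap23.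
have e5 : T = \sum_s \sum_t \sum_r H r t s by rewrite e4 swap12.
apply: (@scalerI _ _ (6%:R : F)); first by rewrite pnatr_eq0.
rewrite scaler0 scaler_nat.
transitivity (T + \sum_s \sum_t \sum_r H s r t + \sum_s \sum_t \sum_r H t s r +
    \sum_s \sum_t \sum_r H t r s + \sum_s \sum_t \sum_r H r s t +
    \sum_s \sum_t \sum_r H r t s).
  by rewrite -e1 -e2 -e3 -e4 -e5 !mulrS mulr0n addr0 !addrA.
rewrite -!big_split big1 // => s _; rewrite -!big_split big1 // => t _.
by rewrite -!big_split big1 // => r _; exact: H0.
Qed.

Lemma triple_sumBBB (H1 H2 H3 H4 : I -> I -> I -> V) :
  \sum_s \sum_t \sum_r H1 s t r - \sum_s \sum_t \sum_r H2 s t r -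
  (\sum_s \sum_t \sum_r H3 s t r - \sum_s \sum_t \sum_r H4 s t r) =
  \sum_s \sum_t \sum_r (H1 s t r - H2 s t r - (H3 s t r - H4 s t r)).
Proof.
rewrite -!sumrB; apply: eq_bigr => s _; rewrite -!sumrB; apply: eq_bigr => t _.
by rewrite -!sumrB.
Qed.

End SymmetricSums.

(** An operator that moves one factor s by d, with the delta function at its
    point a_s, and a value of gamma for every factor that comes before s.  The
    current e is the case where d = 1 and the factors on the left of s come
    before s; the current f is the case of the inverse parameters, where d = -1
    and the factors on the right of s come before s. *)
Section Currents.
Variables (F : numFieldType) (q1 q2 q3 : F).
Hypotheses (q1_neq0 : q1 != 0) (q123 : q1 * q2 * q3 = 1).
Variables (N : nat) (before : rel 'I_N) (d : int).
Hypotheses (before_irr : irreflexive before)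
  (before_total : forall s t, s != t -> before t s = ~~ before s t).
Variable a : {ffun 'I_N -> int} -> 'I_N -> F.
Hypotheses (a_neq0 : forall i s, a i s != 0)
  (a_shift : forall i s t,
     a (shift i t d) s = if s == t then q1 * a i s else a i s)
  (a_generic : forall i s t (k : int), s != t -> a i s != q1 ^ k * a i t).
Implicit Types (i : {ffun 'I_N -> int}) (s t r : 'I_N) (E : seq 'I_N).

Local Notation V := {malg F[{ffun 'I_N -> int}]}.
Local Notation gamma_at := (gamma_at q1 q2 q3).
Local Notation g := (g q1 q2 q3).

Lemma shiftC i s t (c e : int) : shift (shift i s c) t e = shift (shift i t e) s c.
Proof.
apply/ffunP => l; rewrite !ffunE; case: eqP => _; case: eqP => _ //.
exact: addrAC.
Qed.

Lemma a_shift_eq i s : a (shift i s d) s = q1 * a i s.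
Proof. by rewrite a_shift eqxx. Qed.
Lemma a_shift_neq i s t : s != t -> a (shift i t d) s = a i s.
Proof. by rewrite a_shift => /negbTE ->. Qed.

Lemma a_apart i s t : s != t -> apart q1 (a i s) (a i t).
Proof.
move=> st; have ts : t != s by rewrite eq_sym.
have := (a_generic i 0 ts, a_generic i 1 ts, a_generic i 1 st).
by rewrite /apart expr0z mul1r !expr1z => -[[-> ->] ->].
Qed.

Definition weight i s : F := \prod_(l | before l s) gamma_at (a i l) (a i s).

(** Leaving out E, the weight does not change when other elements of E move. *)
Definition weight_off E i s : F :=
  \prod_(l | before l s && (l \notin E)) gamma_at (a i l) (a i s).

Definition weight_factor i s t : F :=
  if before t s then gamma_at (a i t) (a i s) else 1.

Lemma weight_split E i s : uniq E ->
  weight i s = weight_off E i s * \prod_(t <- E) weight_factor i s t.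
Proof.
move=> uE; rewrite /weight (bigID (mem E)) /= mulrC; congr (_ * _).
rewrite big_uniq //= [LHS]big_mkcond [RHS]big_mkcond /=.
by apply: eq_bigr => t _; rewrite /weight_factor; case: before; case: (t \in E).
Qed.

Lemma weight_off_eq E i j s : (forall l, l \notin E -> a j l = a i l) ->
  a j s = a i s -> weight_off E j s = weight_off E i s.
Proof.
by move=> eqE eqs; apply: eq_bigr => l /andP[_ lE]; rewrite eqs eqE.
Qed.

Lemma weight_off_shift E i s t : t \in E -> t != s ->
  weight_off E (shift i t d) s = weight_off E i s.
Proof.
move=> tE ts; apply: weight_off_eq => [l lE|]; rewrite a_shift_neq // 1?eq_sym //.
by apply: contraNneq lE => <-.
Qed.

(** If t comes before s, only the first weight sees the other factor; if s comes
    before t, only the second does, after s has moved from a_s to q1 a_s.  The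
    two values of gamma agree by [gamma_at_shift]. *)
Lemma weight_factor_exchange i s t : s != t ->
  weight_factor i s t * weight_factor (shift i s d) t s = gamma_at (a i t) (a i s).
Proof.
move=> st; rewrite /weight_factor (before_total st) a_shift_eq a_shift_neq 1?eq_sym //.
by case: before; rewrite ?mul1r ?mulr1 ?gamma_at_shift.
Qed.

Lemma weight_factor_self i s : weight_factor i s s = 1.
Proof. by rewrite /weight_factor before_irr. Qed.

(** For moves of distinct factors, all but the exchange factors is symmetric; E
    lists these factors in a fixed order, while their moves are permuted. *)
Lemma weight2 E i s t : uniq E -> perm_eq [:: s; t] E ->
  weight i s * weight (shift i s d) t =
  weight_off E i s * weight_off E i t * gamma_at (a i t) (a i s).
Proof.
move=> uE stE; have := uE; rewrite -(perm_uniq stE) /= inE andbT => st.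
have sE : s \in E by rewrite -(perm_mem stE) inE eqxx.
rewrite !(weight_split _ _ uE) weight_off_shift //.
rewrite -!(perm_big _ stE) !big_cons !big_nil /=.
rewrite -(weight_factor_exchange i st) !weight_factor_self; ring.
Qed.

Lemma weight3 E i s t r : uniq E -> perm_eq [:: s; t; r] E ->
  weight i s * weight (shift i s d) t * weight (shift (shift i s d) t d) r =
  weight_off E i s * weight_off E i t * weight_off E i r *
  (gamma_at (a i t) (a i s) * gamma_at (a i r) (a i s) * gamma_at (a i r) (a i t)).
Proof.
move=> uE strE; have := uE; rewrite -(perm_uniq strE) /= !inE negb_or andbT.
case/andP => /andP[st sr] tr.
have sE : s \in E by rewrite -(perm_mem strE) !inE eqxx.
have tE : t \in E by rewrite -(perm_mem strE) !inE eqxx orbT.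
rewrite !(weight_split _ _ uE) !weight_off_shift //.
rewrite -!(perm_big _ strE) !big_cons !big_nil /=.
rewrite -(weight_factor_exchange i st) -(weight_factor_exchange i sr).
have -> : gamma_at (a i r) (a i t) =
    weight_factor (shift i s d) t r * weight_factor (shift (shift i s d) t d) r t.
  by rewrite weight_factor_exchange // !a_shift_neq // eq_sym.
have -> : weight_factor (shift (shift i s d) t d) r s = weight_factor (shift i s d) r s.
  by rewrite /weight_factor !(a_shift_neq _ (t := t)) // eq_sym.
rewrite !weight_factor_self; ring.
Qed.

Variable kappa : F.

Definition current (n : int) i : V :=
  \sum_s (kappa * weight i s * a i s ^ n) *: << shift i s d >>.
Definition current_op (n : int) : V -> V := linear_extension (current n).

Lemma current_op_linear n : linear (current_op n).
Proof. exact: linear_extension_linear. Qed.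

Lemma current_opU n i : current_op n << i >> =
  \sum_s (kappa * weight i s * a i s ^ n) *: << shift i s d >>.
Proof. exact: linear_extensionU. Qed.

Definition first_point i (p : 'I_N * 'I_N) : F := a i p.1.
Definition second_point i (p : 'I_N * 'I_N) : F := a (shift i p.1 d) p.2.
Lemma first_point_neq0 i p : first_point i p != 0. Proof. exact: a_neq0. Qed.
Lemma second_point_neq0 i p : second_point i p != 0. Proof. exact: a_neq0. Qed.

Definition two_steps i (p : 'I_N * 'I_N) : V :=
  (kappa ^+ 2 * (weight i p.1 * weight (shift i p.1 d) p.2)) *:
    << shift (shift i p.1 d) p.2 d >>.

Lemma current_op2 m n i :
  current_op m (current_op n << i >>) =
  \sum_p (second_point i p ^ m * first_point i p ^ n) *: two_steps i p.
Proof.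
rewrite current_opU (linear_comb (current_op_linear m)).
rewrite -(pair_bigA _ (fun s t =>
  (second_point i (s, t) ^ m * first_point i (s, t) ^ n) *: two_steps i (s, t))).
apply: eq_bigr => s _; rewrite current_opU scaler_sumr.
apply: eq_bigr => t _; rewrite /two_steps !scalerA /=; congr (_ *: _).
rewrite /second_point /first_point /=; ring.
Qed.

(** Two moves of the same factor contribute 0 because g(q1 x, x) = 0, and the two
    orders of the moves of two factors cancel by [gamma_at_antisym]. *)
Lemma current_quadratic m n i :
  \sum_p (g_left q1 q2 q3 (first_point i p) (fun k => second_point i p ^ k) m *
            first_point i p ^ n) *: two_steps i p +
  \sum_p (g_right q1 q2 q3 (second_point i p) (fun k => first_point i p ^ k) m *
            second_point i p ^ n) *: two_steps i p = 0.
Proof.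
rewrite -big_split /=.
pose H s t : V := (g (second_point i (s, t)) (first_point i (s, t)) *
            second_point i (s, t) ^ m * first_point i (s, t) ^ n) *: two_steps i (s, t) +
  (g (second_point i (s, t)) (first_point i (s, t)) *
            first_point i (s, t) ^ m * second_point i (s, t) ^ n) *: two_steps i (s, t).
transitivity (\sum_p H p.1 p.2).
  apply: eq_bigr => -[s t] _; rewrite /H {H}.
  set x := second_point i (s, t); set y := first_point i (s, t).
  have x0 : x != 0 by exact: second_point_neq0.
  have y0 : y != 0 by exact: first_point_neq0.
  move: x y x0 y0 (two_steps _ _) => x y x0 y0 w.
  by rewrite (g_left_exp q1 q2 q3 y m x0) (g_right_exp q1 q2 q3 x m y0).
rewrite -(pair_bigA _ H); apply: double_sum_eq0 => s t; rewrite /H {H}.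
rewrite /two_steps /second_point /first_point /=.
have [->|st] := eqVneq s t.
  by rewrite a_shift_eq /g subrr !mul0r !scale0r !addr0.
have ts : t != s by rewrite eq_sym.
have uE : uniq [:: s; t] by rewrite /= inE st.
have tsE : perm_eq [:: t; s] [:: s; t] by rewrite (perm_catC [:: t] [:: s]).
rewrite (weight2 i uE (perm_refl _)) (weight2 i uE tsE) !a_shift_neq //.
rewrite (shiftC i t s) !scalerA -!scalerDl.
set x := a i s; set y := a i t; set U := weight_off _ _ _; set W := weight_off _ _ _.
have anti := gamma_at_antisym q2 q3 q1_neq0 (a_apart i st).
rewrite -/x -/y in anti *; rewrite [X in X *: _](_ : _ = 0) ?scale0r //.
transitivity ((x ^ m * y ^ n + y ^ m * x ^ n) * kappa ^+ 2 * U * W *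
   (g y x * gamma_at y x + g x y * gamma_at x y)); first by ring.
by rewrite anti addNr mulr0.
Qed.

(** The contribution to the Serre relation of moving s, then t, then r. *)
Definition three_steps i s t r : V :=
  (kappa ^+ 3 * (weight i s * weight (shift i s d) t * weight (shift (shift i s d) t d) r)
   * serre_kernel (a (shift (shift i s d) t d) r) (a (shift i s d) t) (a i s)) *:
    << shift (shift (shift i s d) t d) r d >>.

Lemma current_op3 m n k i :
  current_op m (current_op n (current_op k << i >>)) =
  \sum_s \sum_t \sum_r
    (kappa ^+ 3 * (weight i s * weight (shift i s d) t * weight (shift (shift i s d) t d) r)
     * (a (shift (shift i s d) t d) r ^ m * a (shift i s d) t ^ n * a i s ^ k)) *:
    << shift (shift (shift i s d) t d) r d >>.
Proof.
rewrite current_opU (linear_comb (current_op_linear n)).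
rewrite (linear_comb (current_op_linear m)).
apply: eq_bigr => s _; rewrite current_opU (linear_comb (current_op_linear m)).
rewrite scaler_sumr; apply: eq_bigr => t _; rewrite current_opU.
rewrite scalerA scaler_sumr; apply: eq_bigr => r _; rewrite scalerA; congr (_ *: _).
ring.
Qed.

Lemma three_steps_perm E i s t r : uniq E -> perm_eq [:: s; t; r] E ->
  three_steps i s t r =
  (kappa ^+ 3 * (weight_off E i s * weight_off E i t * weight_off E i r) *
   (gamma_at (a i t) (a i s) * gamma_at (a i r) (a i s) * gamma_at (a i r) (a i t)
    * serre_kernel (a i r) (a i t) (a i s))) *:
    << shift (shift (shift i s d) t d) r d >>.
Proof.
move=> uE strE; rewrite /three_steps (weight3 i uE strE).
have := uE; rewrite -(perm_uniq strE) /= !inE negb_or andbT.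
case/andP => /andP[st sr] tr.
rewrite (a_shift_neq (shift i s d)) 1?eq_sym // !(a_shift_neq i) 1?eq_sym //.
by congr (_ *: _); ring.
Qed.

Lemma three_steps_distinct i s t r : s != t -> s != r -> t != r ->
  three_steps i s t r + three_steps i s r t + three_steps i t s r
  + three_steps i t r s + three_steps i r s t + three_steps i r t s = 0.
Proof.
move=> st sr tr; pose E := [:: s; t; r].
have uE : uniq E by rewrite /= !inE negb_or st sr tr.
rewrite !(three_steps_perm (E := E)) //; try by apply/permP => p /=; ring.
have -> : shift (shift (shift i s d) r d) t d = shift (shift (shift i s d) t d) r d.
  exact: shiftC.
have -> : shift (shift (shift i t d) r d) s d = shift (shift (shift i s d) t d) r d.
  by rewrite shiftC (shiftC i).
have -> : shift (shift (shift i r d) t d) s d = shift (shift (shift i s d) t d) r d.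
  by rewrite (shiftC i) shiftC (shiftC i).
have -> : shift (shift (shift i r d) s d) t d = shift (shift (shift i s d) t d) r d.
  by rewrite (shiftC i) shiftC.
rewrite (shiftC i t s) -!scalerDl [X in X *: _](_ : _ = 0) ?scale0r //.
have /= := serre_distinct q1_neq0 q123 (a_neq0 i s) (a_neq0 i t) (a_neq0 i r)
  (a_apart i st) (a_apart i sr) (a_apart i tr).
set Z := _ + _; move=> Z0; rewrite -[RHS](mulr0 (kappa ^+ 3 *
  (weight_off E i s * weight_off E i t * weight_off E i r))) -Z0 /Z; ring.
Qed.

Lemma three_steps_double i s r : s != r ->
  three_steps i s s r + three_steps i s r s + three_steps i r s s = 0.
Proof.
move=> sr; have rs : r != s by rewrite eq_sym.
set x := a i s; set y := a i r.
pose U := weight_off [:: r] i s * weight_off [:: r] (shift i s d) s *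
  weight_off [:: s] i r * weight_factor i s r.
have split1 j t l : weight j t = weight_off [:: l] j t * weight_factor j t l.
  by rewrite (@weight_split [:: l]) // big_seq1.
have off j t l : t != l -> weight_off [:: t] (shift j t d) l = weight_off [:: t] j l.
  by move=> tl; rewrite weight_off_shift ?inE.
(* Whichever of s and r comes first, the three orders of the moves have the
   weights of [serre_double] up to the factor U. *)
have ssr : weight i s * weight (shift i s d) s * weight (shift (shift i s d) s d) r =
    U * gamma_at y (q1 * x).
  rewrite (split1 i s r) (split1 _ s r) (split1 _ r s) !off //.
  rewrite /U /weight_factor (before_total sr) !a_shift_eq !(a_shift_neq _ rs) -/x -/y.
  by case: before => /=; rewrite ?gamma_at_shift //; ring.
have srs : weight i s * weight (shift i s d) r * weight (shift (shift i s d) r d) s =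
    U * gamma_at y x.
  rewrite (split1 i s r) (split1 _ s r) (split1 _ r s) !off //.
  rewrite /U /weight_factor (before_total sr) !a_shift_eq !(a_shift_neq _ rs, a_shift_neq _ sr).
  rewrite a_shift_eq -/x -/y.
  by case: before => /=; rewrite ?gamma_at_shift //; ring.
have rss : weight i r * weight (shift i r d) s * weight (shift (shift i r d) s d) s =
    U * gamma_at x y.
  rewrite (shiftC i r s) (split1 i r s) !(split1 _ s r) !off //.
  rewrite /U /weight_factor (before_total sr) !a_shift_eq !(a_shift_neq _ rs, a_shift_neq _ sr).
  rewrite !a_shift_eq -/x -/y.
  by case: before => /=; rewrite ?gamma_at_shift //; ring.
rewrite /three_steps ssr srs rss !(a_shift_eq, a_shift_neq _ rs, a_shift_neq _ sr) -/x -/y.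
rewrite (shiftC i r s) (shiftC (shift i s d) r s) -!scalerDl.
rewrite [X in X *: _](_ : _ = 0) ?scale0r //.
have /= := @serre_double _ q1 q2 q3 q1_neq0 q123 x y (a_neq0 i s) (a_neq0 i r)
  (a_apart i sr) (a_generic i 2 rs).
set Z := _ + _; move=> Z0; rewrite -[RHS](mulr0 (kappa ^+ 3 * U)) -Z0 /Z; ring.
Qed.

Lemma three_steps_self i s : three_steps i s s s = 0.
Proof.
by rewrite /three_steps !a_shift_eq (mulrA q1 q1) -expr2 serre_triple // mulr0 scale0r.
Qed.

Lemma current_serre i :
  let c := current_op in
  c 0 (c 1 (c (- 1) << i >>)) - c 0 (c (- 1) (c 1 << i >>)) -
  (c 1 (c (- 1) (c 0 << i >>)) - c (- 1) (c 1 (c 0 << i >>))) = 0.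
Proof.
move=> c; transitivity (\sum_s \sum_t \sum_r three_steps i s t r).
  pose sub (x y : V) := x - y.
  apply: etrans (congr2 sub
    (congr2 sub (current_op3 0 1 (- 1) i) (current_op3 0 (- 1) 1 i))
    (congr2 sub (current_op3 1 (- 1) 0 i) (current_op3 (- 1) 1 0 i))) _.
  apply: etrans (triple_sumBBB _ _ _ _) _.
  apply: eq_bigr => s _; apply: eq_bigr => t _; apply: eq_bigr => r _.
  rewrite -!scalerBl; congr (_ *: _).
  rewrite /serre_kernel !expr0z !expr1z !exprN1; ring.
apply: triple_sum_eq0 => s t r.
have solve (A B C : V) : A + B + C = 0 -> C = - (A + B).
  by move=> /eqP; rewrite addrC addr_eq0 => /eqP.
have [<-|st] := eqVneq s t; have [<-|sr] := eqVneq s r.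
- by rewrite three_steps_self !addr0.
- move: (three_steps_double i sr).
  move: (three_steps i s s r) (three_steps i s r s) (three_steps i r s s).
  by move=> A B C /solve->; rewrite -(addrA (A + B)) addrK subrr.
- move: (three_steps_double i st).
  move: (three_steps i s s t) (three_steps i s t s) (three_steps i t s s).
  by move=> A B C /solve->; rewrite (addrC B A) subrr sub0r -addrA addNr.
have [<-|tr] := eqVneq t r; last exact: three_steps_distinct.
rewrite eq_sym in st; move: (three_steps_double i st).
move: (three_steps i t t s) (three_steps i t s t) (three_steps i s t t).
move=> A B C /solve->; rewrite -addrA (addrC B A) -(addrA _ B A) (addrC B A).
by rewrite subrK addNr.
Qed.

End Currents.

(** * The currents psi *)

Section TwoSided.
Variable F : fieldType.
Implicit Types (b : bool) (f : series F).

(** The coefficients of a power series in 1/z (b = true) or in z (b = false),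
    indexed by minus the exponent of z. *)
Definition two_sided b f (n : int) : F :=
  if 0 <= (if b then n else - n) then f `|n|%N else 0.

(** The factor z - c is z times [one_minus true c] in the variable 1/z, and is
    [one_minus false c] in the variable z, hence the shift by b. *)
Lemma two_sided_one_minus b c f n :
  two_sided b f (n + 1) - c * two_sided b f n =
  two_sided b (series_of_poly (one_minus b c) * f) (n + b%:Z).
Proof.
have pE m : (series_of_poly (one_minus true c) * f) m.+1 = f m.+1 - c * f m.
  rewrite rmorphB mulrBl rmorph1 mul1r -mul_polyC rmorphM -mulrA.
  by rewrite coef_seriesB coef_seriesCM coef_seriesXM.
have p0 : (series_of_poly (one_minus true c) * f) 0%N = f 0%N.
  by rewrite coef0_seriesM /series_of_poly coefB coef1 coefZ coefX mulr0 subr0 mul1r.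
have nE m : (series_of_poly (one_minus false c) * f) m.+1 = f m - c * f m.+1.
  by rewrite rmorphB mulrBl coef_seriesB coef_seriesCM coef_seriesXM.
have n0 : (series_of_poly (one_minus false c) * f) 0%N = - (c * f 0%N).
  by rewrite coef0_seriesM /series_of_poly coefB coefX coefC sub0r mulNr.
rewrite /two_sided; case: b; case: n => [n|n]; rewrite ?addr0 /=.
- by rewrite /= addn1; exact/esym/pE.
- case: n => [|n]; first by rewrite /= mulr0 subr0; exact/esym/p0.
  rewrite (_ : Negz n.+1 + 1 = Negz n) //=; last by lia.
  by rewrite mulr0 subr0.
- case: n => [|n]; first by rewrite /= sub0r; exact/esym/n0.
  by rewrite /= mulr0 subr0.
- case: n => [|n]; first exact/esym/nE.
  by rewrite (_ : Negz n.+1 + 1 = Negz n) ?nE //; lia.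
Qed.

Variables (q1 q2 q3 : F).

Lemma g_left_two_sided b y f m :
  g_left q1 q2 q3 y (two_sided b f) m =
  two_sided b (series_of_poly (one_minus b (q1 * y) *
    (one_minus b (q2 * y) * one_minus b (q3 * y))) * f) (m + b%:Z + b%:Z + b%:Z).
Proof.
have step q h e : mul_zBq q y (fun m => two_sided b h (m + e)) =
    (fun m => two_sided b (series_of_poly (one_minus b (q * y)) * h) (m + (e + b%:Z))).
  by apply/funext => k; rewrite addrA -two_sided_one_minus /mul_zBq addrAC.
have start : two_sided b f = (fun m => two_sided b f (m + 0)).
  by apply/funext => k; rewrite addr0.
rewrite /g_left start 3!step add0r !addrA !rmorphM /= -!mulrA.
by congr (two_sided _ _ _); ring.
Qed.

Hypotheses (q1_neq0 : q1 != 0) (q123 : q1 * q2 * q3 = 1).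

Let q2_neq0 : q2 != 0 := factor2_neq0 q123.
Let q3_neq0 : q3 != 0 := factor3_neq0 q123.

(** Each factor y - q z of g(y, z) is - q (z - y / q). *)
Lemma g_right_dual y phi m :
  g_right q1 q2 q3 y phi m = - g_left q1^-1 q2^-1 q3^-1 y phi m.
Proof.
have dual q h : q != 0 -> mul_Bqz q y h = (fun m => - q * mul_zBq q^-1 y h m).
  by move=> q0; apply/funext => k; rewrite /mul_Bqz /mul_zBq; field.
rewrite /g_right /g_left !dual // -[RHS]mul1r -q123.
rewrite /mul_zBq; ring.
Qed.

Lemma residue_dual : q1 != 1 -> residue q1^-1 q2^-1 q3^-1 = - residue q1 q2 q3.
Proof.
move=> q1_neq1; have q3E := factor3E q123.
have n1 : q1 - 1 != 0 by rewrite subr_eq0.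
have n2 : 1 - q1 != 0 by rewrite subr_eq0 eq_sym.
by rewrite /residue invrK q3E; field; rewrite q1_neq0 q2_neq0 n1 n2 oner_neq0.
Qed.

(** This is [gamma_at_dual] for the expansions: the two poles are exchanged, and
    so are their opposite residues. *)
Lemma gamma_series_dual b x : q1 != 1 ->
  gamma_series q1^-1 q2^-1 q3^-1 b (x / q1) = gamma_series q1 q2 q3 b x.
Proof.
move=> q1_neq1; rewrite /gamma_series residue_dual // invrK divfK //.
by rewrite rmorphN mulNr -mulrN opprB.
Qed.

End TwoSided.

Section PsiEigenvalues.
Variables (F : fieldType) (q1 q2 q3 : F).
Hypotheses (q1_neq0 : q1 != 0) (q1_neq1 : q1 != 1) (q123 : q1 * q2 * q3 = 1).
Variables (N : nat).
Implicit Types (x : 'I_N -> F) (b : bool).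

Local Notation gamma_at := (gamma_at q1 q2 q3).
Local Notation r := (residue q1 q2 q3).

Definition psi_eigenseries x b : series F := \prod_s gamma_series q1 q2 q3 b (x s).

Lemma coef0_psi_eigenseries x b : psi_eigenseries x b 0%N = 1.
Proof. by apply: coef0_series_prod1 => s _; exact: coef0_gamma_series. Qed.

Lemma psi_eigenseries_shift x x' s b m : x s != 0 ->
  (forall t, x' t = if t == s then q1 * x t else x t) ->
  g_left q1 q2 q3 (x s) (two_sided b (psi_eigenseries x' b)) m =
  - g_right q1 q2 q3 (x s) (two_sided b (psi_eigenseries x b)) m.
Proof.
move=> xs0 x'E; rewrite g_right_dual // opprK !g_left_two_sided; congr two_sided.
rewrite /psi_eigenseries (bigD1 s) //= [in RHS](bigD1 s) //= x'E eqxx.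
rewrite [LHS]mulrA [RHS]mulrA.
rewrite (eq_bigr (fun t => gamma_series q1 q2 q3 b (x t))); last first.
  by move=> t /negbTE ts; rewrite x'E ts.
congr (_ * _); rewrite gamma_series_shift //.
by rewrite ![_^-1 * _]mulrC.
Qed.

(** The product of the functions gamma has simple poles, and the two expansions
    of a polar part 1 / (1 - p / z) differ by the delta function delta(p / z). *)
Lemma psi_eigenseries_difference x n : (forall s, x s != 0) ->
  (forall s t, s != t ->
     [&& x s != x t, x s != x t / q1, x s / q1 != x t & x s / q1 != x t / q1]) ->
  two_sided true (psi_eigenseries x true) n -
  two_sided false (psi_eigenseries x false) n =
  \sum_s r * ((\prod_(t | t != s) gamma_at (x t) (x s)) * x s ^ n -
              (\prod_(t | t != s) gamma_at (x t) (x s / q1)) * (x s / q1) ^ n).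
Proof.
move=> x0 x_apart; have y0 s : x s / q1 != 0 by rewrite mulf_neq0 ?invr_neq0.
pose A s := \prod_(t | t != s) gamma_at (x t) (x s).
pose B s := \prod_(t | t != s) gamma_at (x t) (x s / q1).
have coefE b k : psi_eigenseries x b k = (k == 0%N)%:R +
    \sum_s r * (A s * geometric b (x s) k - B s * geometric b (x s / q1) k).
  have uI : uniq (index_enum 'I_N) by exact: index_enum_uniq.
  rewrite /psi_eigenseries /gamma_series.
  rewrite (@prod_partial_fractions _ _ r x (fun s => x s / q1) x0 y0 _ uI) //.
  - rewrite coef_seriesD coef_series1 coef_series_sum; congr (_ + _).
    apply: eq_bigr => s _; rewrite coef_seriesB !coef_seriesCM -!(mulrA r) -mulrBr.
    congr (_ * (_ * _ - _ * _)); apply: eq_bigr => t ts.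
      case/and4P: (x_apart _ _ ts) => ? ? ? ?; exact: gamma_at_fraction_eval.
    case/and4P: (x_apart _ _ ts) => ? ? ? ?; exact: gamma_at_fraction_eval.
  - by move=> s t _ _; exact: x_apart.
  - move=> p p' pin p'in pp'; apply: geometric_mul => //.
      by move: pin; rewrite mem_cat => /orP[]/mapP[s _ ->].
    by move: p'in; rewrite mem_cat => /orP[]/mapP[s _ ->].
have negE p k : p ^ Negz k = p ^- k.+1 :> F by [].
rewrite /two_sided; case: n => n; last first.
  rewrite /= coefE /= !add0r -sumrN.
  apply: eq_bigr => s _; rewrite /geometric /= -/(A s) -/(B s) !negE; ring.
case: n => [|n] /=.
  rewrite (coefE true 0%N) (coefE false 0%N).
  rewrite opprD addrACA subrr add0r -sumrN -big_split.
  apply: eq_bigr => s _; rewrite /geometric /= invr1 !expr0 !expr0z.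
  by rewrite -/(A s) -/(B s); ring.
rewrite subr0 coefE add0r; apply: eq_bigr => s _.
by rewrite /geometric -!exprnP.
Qed.

End PsiEigenvalues.

(** * The action on the tensor product *)

Section Action.
Variables (F : numFieldType) (q1 q2 q3 : F).
Hypotheses (q1_neq0 : q1 != 0) (q1_neq1 : q1 != 1)
  (q2_neq1 : q2 != 1) (q3_neq1 : q3 != 1) (q123 : q1 * q2 * q3 = 1).
Variables (N : nat) (u : 'I_N -> F).
Hypotheses (u_neq0 : forall s, u s != 0)
  (u_generic : forall (s t : 'I_N) (k : int), (s < t)%N -> u s / u t != q1 ^ k).
Implicit Types (i : {ffun 'I_N -> int}) (s t : 'I_N) (b : bool).

Local Notation V := {malg F[{ffun 'I_N -> int}]}.

Definition e_point i s : F := q1 ^ i s * u s.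
Definition f_point i s : F := q1 ^ (i s - 1) * u s.

Definition e_before : rel 'I_N := fun l s => (l < s)%N.
Definition f_before : rel 'I_N := fun l s => (s < l)%N.

Definition e_op : int -> V -> V :=
  current_op q1 q2 q3 e_before 1 e_point (1 - q1)^-1.
(** The current f is a current of type e for the inverse parameters and the
    reversed order of the factors. *)
Definition f_op : int -> V -> V :=
  current_op q1^-1 q2^-1 q3^-1 f_before (- 1) f_point (- (1 - q1^-1))^-1.

Definition eigenseries b i : series F := psi_eigenseries q1 q2 q3 (e_point i) b.

Definition psi_op b (k : nat) : V -> V :=
  linear_extension (fun i => eigenseries b i k *: (<< i >> : V)).

(** The coefficients psi_0 act by 1, as gamma is 1 at 0 and at infinity, so that
    their inverses do as well. *)
Definition generator_op (x : Egen) : V -> V :=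
  match x with
  | Ge n => e_op n
  | Gf n => f_op n
  | Gpsi b k => psi_op b k
  | GpsiV _ => id
  end.

Local Notation ev := (eval_expr generator_op).

Lemma generator_op_linear x : linear (generator_op x).
Proof. by case: x => [n|n|b k|b]; try exact: linear_extension_linear. Qed.

Lemma eval_basis (x y : expr F Egen) :
  (forall i, ev x << i >> = ev y << i >>) -> ev x =1 ev y.
Proof. by apply: linear_malg_ext; apply/eval_expr_linear/generator_op_linear. Qed.

Let q1V_neq0 : q1^-1 != 0. Proof. by rewrite invr_neq0. Qed.
Let q1V_neq1 : q1^-1 != 1. Proof. by rewrite invr_eq1. Qed.
Let q123V : q1^-1 * q2^-1 * q3^-1 = 1. Proof. by rewrite -!invfM q123 invr1. Qed.

Lemma f_pointE i s : f_point i s = e_point i s / q1.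
Proof. by rewrite /f_point /e_point expfzDr // exprN1 mulrAC. Qed.

Lemma e_point_neq0 i s : e_point i s != 0.
Proof. by rewrite mulf_neq0 ?expfz_neq0. Qed.
Lemma f_point_neq0 i s : f_point i s != 0.
Proof. by rewrite mulf_neq0 ?expfz_neq0. Qed.

Lemma e_point_shift i s t :
  e_point (shift i t 1) s = if s == t then q1 * e_point i s else e_point i s.
Proof.
rewrite /e_point ffunE; case: eqP => // _.
by rewrite expfzDr // expr1z mulrAC mulrC mulrA.
Qed.
Lemma e_point_unshift i s t :
  e_point (shift i t (- 1)) s = if s == t then f_point i s else e_point i s.
Proof. by rewrite /e_point /f_point ffunE; case: eqP. Qed.
Lemma f_point_shift i s t :
  f_point (shift i t (- 1)) s = if s == t then q1^-1 * f_point i s else f_point i s.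
Proof.
by rewrite !f_pointE e_point_unshift; case: eqP => // _; rewrite f_pointE mulrC.
Qed.
Lemma f_point_unshift i s t :
  f_point (shift i t 1) s = if s == t then e_point i s else f_point i s.
Proof.
by rewrite !f_pointE e_point_shift; case: eqP => // _; rewrite mulrAC divff // mul1r.
Qed.

Lemma u_apart s t k : s != t -> u s != q1 ^ k * u t.
Proof.
move=> st; wlog lt_st : s t k st / (s < t)%N.
  move=> W; have [lt_st|lt_ts|/val_inj/eqP] := ltngtP s t; first exact: W.
    have ts : t != s by rewrite eq_sym.
    apply: contra_neq (W t s (- k) ts lt_ts) => ->.
    by rewrite mulrA -expfzDr // addNr expr0z mul1r.
  by rewrite (negbTE st).
by apply: contra_neq (u_generic k lt_st) => ->; rewrite mulfK.
Qed.

Lemma e_point_generic i s t k : s != t -> e_point i s != q1 ^ k * e_point i t.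
Proof.
move=> st; apply: contra_neq (u_apart (k + i t - i s) st) => eq_st.
apply: (mulfI (expfz_neq0 (i s) q1_neq0)); rewrite -/(e_point i s) eq_st.
by rewrite /e_point !mulrA -!expfzDr // addrCA subrr addr0.
Qed.

Lemma f_point_generic i s t k : s != t -> f_point i s != (q1^-1) ^ k * f_point i t.
Proof.
move=> st; rewrite !f_pointE mulrA exprz_inv (inj_eq (mulIf q1V_neq0)).
exact: e_point_generic.
Qed.

Lemma e_before_total s t : s != t -> e_before t s = ~~ e_before s t.
Proof. by rewrite /e_before -val_eqE /=; lia. Qed.
Lemma f_before_total s t : s != t -> f_before t s = ~~ f_before s t.
Proof. by rewrite /f_before -val_eqE /=; lia. Qed.
Lemma e_before_irr : irreflexive e_before. Proof. by move=> s; exact: ltnn. Qed.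
Lemma f_before_irr : irreflexive f_before. Proof. by move=> s; exact: ltnn. Qed.

Lemma eigenseries_dual b i :
  psi_eigenseries q1^-1 q2^-1 q3^-1 (f_point i) b = eigenseries b i.
Proof.
by apply: eq_bigr => s _; rewrite f_pointE gamma_series_dual.
Qed.

Lemma eval_psi b n i :
  ev (psi_series F b n) << i >> = two_sided b (eigenseries b i) n *: << i >>.
Proof.
rewrite /psi_series /two_sided; case: ifP => _ /=; last by [].
exact: linear_extensionU.
Qed.

Lemma relation_ee m n :
  ev (mul_gzw q1 q2 q3 (fun m n => e_series F m * e_series F n)%X m n) =1
  ev (- mul_gwz q1 q2 q3 (fun m n => e_series F n * e_series F m) m n)%X.
Proof.
apply: eval_basis => i; rewrite eval_exprN.
pose x := second_point 1 e_point i; pose y := first_point e_point i.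
pose w := two_steps q1 q2 q3 e_before 1 e_point (1 - q1)^-1 i.
have x0 p : x p != 0 by exact: e_point_neq0.
have y0 p : y p != 0 by exact: e_point_neq0.
have D1 : delta_sum generator_op y w << i >> (fun p k => x p ^ k)
    (fun m n => e_series F m * e_series F n)%X.
  by move=> k l; exact: current_op2.
have D2 : delta_sum generator_op x w << i >> (fun p k => y p ^ k)
    (fun m n => e_series F n * e_series F m)%X.
  move=> k l; apply: etrans (current_op2 _ _ _ _ _ _ _ _ _ _) _.
  by apply: eq_bigr => p _; rewrite mulrC.
rewrite (delta_sum_gzw q1 q2 q3 y0 D1) (delta_sum_gwz q1 q2 q3 x0 D2).
apply/eqP; rewrite -addr_eq0; apply/eqP.
exact: (current_quadratic q1_neq0 q123 e_before_irr e_before_total e_point_neq0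
  e_point_shift e_point_generic).
Qed.

Lemma sum_g_right_dual (J : finType) (y : J -> F) (phi : J -> int -> F) (c : J -> F)
    (w : J -> V) m :
  \sum_j (g_right q1 q2 q3 (y j) (phi j) m * c j) *: w j =
  - \sum_j (g_left q1^-1 q2^-1 q3^-1 (y j) (phi j) m * c j) *: w j.
Proof.
by rewrite -sumrN; apply: eq_bigr => j _; rewrite g_right_dual // mulNr scaleNr.
Qed.

Lemma sum_g_left_dual (J : finType) (y : J -> F) (phi : J -> int -> F) (c : J -> F)
    (w : J -> V) m :
  \sum_j (g_left q1 q2 q3 (y j) (phi j) m * c j) *: w j =
  - \sum_j (g_right q1^-1 q2^-1 q3^-1 (y j) (phi j) m * c j) *: w j.
Proof.
rewrite -sumrN; apply: eq_bigr => j _.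
by rewrite (g_right_dual q1V_neq0 q123V) !invrK mulNr scaleNr opprK.
Qed.

Lemma relation_ff m n :
  ev (mul_gwz q1 q2 q3 (fun m n => f_series F m * f_series F n)%X m n) =1
  ev (- mul_gzw q1 q2 q3 (fun m n => f_series F n * f_series F m) m n)%X.
Proof.
apply: eval_basis => i; rewrite eval_exprN.
pose x := second_point (- 1) f_point i; pose y := first_point f_point i.
pose w := two_steps q1^-1 q2^-1 q3^-1 f_before (- 1) f_point (- (1 - q1^-1))^-1 i.
have x0 p : x p != 0 by exact: f_point_neq0.
have y0 p : y p != 0 by exact: f_point_neq0.
have D1 : delta_sum generator_op y w << i >> (fun p k => x p ^ k)
    (fun m n => f_series F m * f_series F n)%X.
  by move=> k l; exact: current_op2.
have D2 : delta_sum generator_op x w << i >> (fun p k => y p ^ k)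
    (fun m n => f_series F n * f_series F m)%X.
  move=> k l; apply: etrans (current_op2 _ _ _ _ _ _ _ _ _ _) _.
  by apply: eq_bigr => p _; rewrite mulrC.
rewrite (delta_sum_gwz q1 q2 q3 y0 D1) (delta_sum_gzw q1 q2 q3 x0 D2).
rewrite (sum_g_left_dual x (fun p k => y p ^ k) (fun p => x p ^ n) w m).
rewrite (sum_g_right_dual y (fun p k => x p ^ k) (fun p => y p ^ n) w m) opprK.
apply/eqP; rewrite eqr_oppLR -addr_eq0; apply/eqP.
exact: (current_quadratic q1V_neq0 q123V f_before_irr f_before_total f_point_neq0
  f_point_shift f_point_generic).
Qed.

Let ev_linear x : linear (ev x).
Proof. exact/eval_expr_linear/generator_op_linear. Qed.

Let evZ x c v : ev x (c *: v) = c *: ev x v.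
Proof.
have ev0 : ev x 0 = 0.
  by have := ev_linear x (-1) 0 0; rewrite scaler0 addr0 scaleN1r addNr.
by have := ev_linear x c v 0; rewrite !addr0 ev0 addr0.
Qed.

Let evB x v w : ev x (v + - 1 *: w) = ev x v - ev x w.
Proof. by rewrite addrC ev_linear scaleN1r addrC. Qed.

(** A current moves the factor s, so that psi acts after it by the eigenvalue of
    the moved vector and before it by that of the original one. *)
Lemma delta_sum_psi_current (p1 p2 p3 kappa : F) (before : rel 'I_N) d
    (a : {ffun 'I_N -> int} -> 'I_N -> F) (x : int -> expr F Egen) b i :
  (forall n j, ev (x n) << j >> = current_op p1 p2 p3 before d a kappa n << j >>) ->
  let w s : V := (kappa * weight p1 p2 p3 before a i s) *: << shift i s d >> in
  delta_sum generator_op (a i) w << i >>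
    (fun s => two_sided b (eigenseries b (shift i s d)))
    (fun m n => psi_series F b m * x n)%X /\
  delta_sum generator_op (a i) w << i >> (fun s => two_sided b (eigenseries b i))
    (fun m n => x n * psi_series F b m)%X.
Proof.
move=> xE w; split=> m n /=.
  rewrite xE current_opU (linear_comb (ev_linear _)); apply: eq_bigr => s _.
  by rewrite eval_psi /w !scalerA; congr (_ *: _); ring.
rewrite eval_psi evZ xE current_opU scaler_sumr; apply: eq_bigr => s _.
by rewrite /w !scalerA; congr (_ *: _); ring.
Qed.

Lemma relation_psie b m n :
  ev (mul_gzw q1 q2 q3 (fun m n => psi_series F b m * e_series F n)%X m n) =1
  ev (- mul_gwz q1 q2 q3 (fun m n => e_series F n * psi_series F b m) m n)%X.
Proof.
apply: eval_basis => i; rewrite eval_exprN.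
have a0 := e_point_neq0 i.
have [|D1 D2] := @delta_sum_psi_current q1 q2 q3 (1 - q1)^-1 e_before 1 e_point
  (e_series F) b i; first by [].
rewrite (delta_sum_gzw q1 q2 q3 a0 D1) (delta_sum_gwz q1 q2 q3 a0 D2) -sumrN.
apply: eq_bigr => s _; rewrite -scaleNr -mulNr.
rewrite (psi_eigenseries_shift q1_neq0 q1_neq1 q123 (x := e_point i)) // => t.
exact: e_point_shift.
Qed.

Lemma relation_psif b m n :
  ev (mul_gwz q1 q2 q3 (fun m n => psi_series F b m * f_series F n)%X m n) =1
  ev (- mul_gzw q1 q2 q3 (fun m n => f_series F n * psi_series F b m) m n)%X.
Proof.
apply: eval_basis => i; rewrite eval_exprN.
have a0 := f_point_neq0 i.
have [|D1 D2] := @delta_sum_psi_current q1^-1 q2^-1 q3^-1 (- (1 - q1^-1))^-1 f_before (- 1)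
  f_point (f_series F) b i; first by [].
rewrite (delta_sum_gwz q1 q2 q3 a0 D1) (delta_sum_gzw q1 q2 q3 a0 D2).
apply: etrans (sum_g_right_dual _ _ _ _ _) _; apply: (congr1 -%R).
apply: etrans _ (esym (sum_g_left_dual _ _ _ _ _)); rewrite -sumrN.
apply: eq_bigr => s _; rewrite -scaleNr -mulNr -!eigenseries_dual.
rewrite (psi_eigenseries_shift q1V_neq0 q1V_neq1 q123V (x := f_point i)) // => t.
exact: f_point_shift.
Qed.

Lemma relation_psipsi b c j k :
  ev (bracket (Gen (Gpsi b j)) (Gen (Gpsi c k))) =1 ev (Const 0).
Proof.
apply: eval_basis => i; rewrite /= /psi_op !scale0r !linear_extensionU.
have Z b' k' (x : F) v : psi_op b' k' (x *: v) = x *: psi_op b' k' v.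
  exact: (evZ (Gen (Gpsi b' k'))).
rewrite -/(psi_op b j) -/(psi_op c k) !Z /psi_op !linear_extensionU.
by rewrite !scalerA -scalerDl mulN1r mulNr [X in X - _]mulrC subrr scale0r.
Qed.

Lemma psi_op0 b v : psi_op b 0 v = v.
Proof.
apply: (@linear_malg_ext _ _ _ (psi_op b 0) id) => //.
  exact: (generator_op_linear (Gpsi b 0)).
by move=> i; rewrite /psi_op linear_extensionU /eigenseries coef0_psi_eigenseries scale1r.
Qed.

Lemma relation_eee :
  ev (bracket (e_series F 0) (bracket (e_series F 1) (e_series F (- 1)))) =1 ev (Const 0).
Proof.
apply: eval_basis => i; rewrite [RHS]scale0r.
rewrite -[LHS]/(ev (e_series F 0) (e_op 1 (e_op (- 1) << i >>) +
    - 1 *: e_op (- 1) (e_op 1 << i >>)) + - 1 *: (e_op 1 (e_op (- 1) (e_op 0 << i >>)) +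
    - 1 *: e_op (- 1) (e_op 1 (e_op 0 << i >>)))) evB !scaleN1r.
exact: (current_serre q1_neq0 q123 e_before_irr e_before_total e_point_neq0
  e_point_shift e_point_generic).
Qed.

Lemma relation_fff :
  ev (bracket (f_series F 0) (bracket (f_series F 1) (f_series F (- 1)))) =1 ev (Const 0).
Proof.
apply: eval_basis => i; rewrite [RHS]scale0r.
rewrite -[LHS]/(ev (f_series F 0) (f_op 1 (f_op (- 1) << i >>) +
    - 1 *: f_op (- 1) (f_op 1 << i >>)) + - 1 *: (f_op 1 (f_op (- 1) (f_op 0 << i >>)) +
    - 1 *: f_op (- 1) (f_op 1 (f_op 0 << i >>)))) evB !scaleN1r.
exact: (current_serre q1V_neq0 q123V f_before_irr f_before_total f_point_neq0
  f_point_shift f_point_generic).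
Qed.

Definition e_weight i s : F := weight q1 q2 q3 e_before e_point i s.
Definition f_weight i s : F := weight q1^-1 q2^-1 q3^-1 f_before f_point i s.

Definition gamma_product i s z : F :=
  \prod_(t | t != s) gamma_at q1 q2 q3 (e_point i t) z.

Let f_gamma i l z : gamma_at q1^-1 q2^-1 q3^-1 (f_point i l) z =
  gamma_at q1 q2 q3 (e_point i l) z.
Proof. by rewrite f_pointE gamma_at_dual. Qed.

(** If s is on the left of t, neither weight sees the other factor; otherwise
    both do, and the two changes of the weights agree by [gamma_at_shift]. *)
Lemma weights_ef_neq i s t : s != t ->
  f_weight i t * e_weight (shift i t (- 1)) s =
  e_weight i s * f_weight (shift i s 1) t.
Proof.
move=> st; rewrite /e_weight /f_weight.
rewrite !(@weight_split _ q1 q2 q3 _ e_before e_point [:: t]) //.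
rewrite !(@weight_split _ q1^-1 q2^-1 q3^-1 _ f_before f_point [:: s]) //.
rewrite !big_seq1.
rewrite [weight_off q1 _ _ _ _ _ (shift _ _ _) _](@weight_off_eq _ q1 q2 q3 _ _ _ _ i).
- rewrite [weight_off q1^-1 _ _ _ _ _ (shift _ _ _) _]
    (@weight_off_eq _ q1^-1 q2^-1 q3^-1 _ _ _ _ i).
  + have fE : weight_factor q1^-1 q2^-1 q3^-1 f_before f_point i t s *
      weight_factor q1 q2 q3 e_before e_point (shift i t (- 1)) s t =
      weight_factor q1 q2 q3 e_before e_point i s t *
      weight_factor q1^-1 q2^-1 q3^-1 f_before f_point (shift i s 1) t s.
      have ts : (t == s) = false by rewrite eq_sym (negbTE st).
      rewrite /weight_factor /f_before /e_before; case: ifP => _; last by [].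
      rewrite !f_gamma; rewrite (e_point_unshift i t t) (e_point_unshift i s t).
      rewrite (f_point_unshift i t s) (e_point_shift i s s).
      rewrite !eqxx (negbTE st) ts.
      rewrite gamma_at_shift //; congr (_ * _).
      by rewrite -[LHS]gamma_at_shift // f_pointE mulrCA divff // mulr1.
    by rewrite mulrACA fE [RHS]mulrACA; congr (_ * _); exact: mulrC.
  + by move=> l; rewrite inE f_point_unshift => /negbTE ->.
  + by rewrite f_point_unshift eq_sym (negbTE st).
- by move=> l; rewrite inE e_point_unshift => /negbTE ->.
- by rewrite e_point_unshift (negbTE st).
Qed.

Lemma gamma_productE i s z : gamma_product i s z =
  (\prod_(l | f_before l s) gamma_at q1 q2 q3 (e_point i l) z) *
  (\prod_(l | e_before l s) gamma_at q1 q2 q3 (e_point i l) z).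
Proof.
rewrite /gamma_product (bigID (fun l => f_before l s)) /=.
congr (_ * _); apply: eq_bigl => l; rewrite /f_before /e_before -val_eqE /=; lia.
Qed.

(** In the diagonal terms, e contributes the factors on the left of s and f those
    on the right, at the same point. *)
Lemma weights_fe_eq i s :
  f_weight i s * e_weight (shift i s (- 1)) s = gamma_product i s (f_point i s).
Proof.
rewrite gamma_productE; congr (_ * _); apply: eq_bigr => l ls.
  by rewrite f_gamma.
rewrite !e_point_unshift eqxx; case: eqP => // ls'.
by move: ls; rewrite ls' /e_before ltnn.
Qed.

Lemma weights_ef_eq i s :
  e_weight i s * f_weight (shift i s 1) s = gamma_product i s (e_point i s).
Proof.
rewrite gamma_productE mulrC; congr (_ * _); apply: eq_bigr => l ls.
rewrite f_gamma f_point_unshift e_point_shift eqxx; case: eqP => // ls'.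
by move: ls; rewrite ls' /f_before ltnn.
Qed.

Lemma shiftK i s (c : int) : shift (shift i s (- c)) s c = i.
Proof. by apply/ffunP => l; rewrite !ffunE; case: eqP => // _; rewrite subrK. Qed.

(** The terms that move two different factors cancel.  The remaining terms are
    delta functions at the poles of the eigenvalue of psi, with coefficients the
    residues given by [psi_eigenseries_difference]. *)
Lemma relation_ef m n :
  ev (bracket (e_series F m) (f_series F n)) =1
  ev ((g q1 q2 q3 1 1)^-1 *:
      mul_deltazw (fun k => psi_series F true k - psi_series F false k) m n)%X.
Proof.
apply: eval_basis => i.
rewrite -[LHS]/(ev (e_series F m) (f_op n << i >>) +
  - 1 *: ev (f_series F n) (e_op m << i >>)) /mul_deltazw.
rewrite -[RHS]/((g q1 q2 q3 1 1)^-1 *: (ev (psi_series F true (m + n)) << i >> +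
  - 1 *: ev (psi_series F false (m + n)) << i >>)) !eval_psi !scaleN1r -scalerBl.
set ke := (1 - q1)^-1; set kf := (- (1 - q1^-1))^-1.
have fe : ev (e_series F m) (f_op n << i >>) =
    \sum_t \sum_s (kf * f_weight i t * f_point i t ^ n *
      (ke * e_weight (shift i t (- 1)) s * e_point (shift i t (- 1)) s ^ m)) *:
      << shift (shift i t (- 1)) s 1 >>.
  rewrite /f_op current_opU (linear_comb (ev_linear _)); apply: eq_bigr => t _.
  rewrite -[ev _ _]/(e_op m << shift i t (- 1) >>) /e_op current_opU scaler_sumr.
  by apply: eq_bigr => s _; rewrite scalerA.
have ef : ev (f_series F n) (e_op m << i >>) =
    \sum_t \sum_s (ke * e_weight i s * e_point i s ^ m *
      (kf * f_weight (shift i s 1) t * f_point (shift i s 1) t ^ n)) *: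
      << shift (shift i t (- 1)) s 1 >>.
  rewrite exchange_big.
  rewrite /e_op current_opU (linear_comb (ev_linear _)); apply: eq_bigr => s _.
  rewrite -[ev _ _]/(f_op n << shift i s 1 >>) /f_op current_opU scaler_sumr.
  by apply: eq_bigr => t _; rewrite scalerA shiftC.
rewrite fe ef -sumrB.
rewrite psi_eigenseries_difference //; last 2 first.
- exact: e_point_neq0.
- move=> s t st.
  have e0 : e_point i s != e_point i t.
    by have := e_point_generic i 0 st; rewrite expr0z mul1r.
  have e1 : e_point i s / q1 != e_point i t.
    apply: contra_neq (e_point_generic i 1 st) => <-.
    by rewrite expr1z mulrCA divff ?mulr1.
  have e2 : e_point i s != e_point i t / q1.
    by have := e_point_generic i (- 1) st; rewrite exprN1 mulrC.
  by rewrite e0 e1 e2 (inj_eq (mulIf q1V_neq0)).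
(* g(1, 1) is the product of the 1 - q_j, which cancels the numerator of the
   residue. *)
have scalars : kf * ke = - ((g q1 q2 q3 1 1)^-1 * residue q1 q2 q3).
  have n1 : q1 - 1 != 0 by rewrite subr_eq0.
  have n1' : 1 - q1 != 0 by rewrite subr_eq0 eq_sym.
  have n2 : 1 - q2 != 0 by rewrite subr_eq0 eq_sym.
  have n3 : 1 - q3 != 0 by rewrite subr_eq0 eq_sym.
  by rewrite /kf /ke /g /residue; field; rewrite ?q1_neq0 ?n1 ?n1' ?n2 ?n3 ?oner_neq0.
rewrite scalerA mulr_sumr scaler_suml; apply: eq_bigr => s _.
rewrite -sumrB (bigD1 s) //= big1 ?addr0 => [|t ts]; rewrite -scalerBl.
  rewrite shiftK (e_point_unshift i s s) (f_point_unshift i s s) eqxx.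
  congr (_ *: _).
  rewrite -/(gamma_product i s (e_point i s)) -f_pointE.
  rewrite -/(gamma_product i s (f_point i s)).
  rewrite -weights_fe_eq -weights_ef_eq !expfzDr ?e_point_neq0 ?f_point_neq0 //.
  transitivity (kf * ke * (f_weight i s * e_weight (shift i s (- 1)) s *
      (f_point i s ^ m * f_point i s ^ n) -
    e_weight i s * f_weight (shift i s 1) s *
      (e_point i s ^ m * e_point i s ^ n))); first by ring.
  rewrite scalars; ring.
rewrite (e_point_unshift i t s) (f_point_unshift i s t) [s == t]eq_sym (negbTE ts).
rewrite [X in X *: _](_ : _ = 0) ?scale0r //.
transitivity (kf * ke * f_point i s ^ n * e_point i t ^ m *
  (f_weight i s * e_weight (shift i s (- 1)) t -
   e_weight i t * f_weight (shift i t 1) s)); first by ring.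
by rewrite weights_ef_neq // subrr mulr0.
Qed.

Lemma generator_op_rel (x y : expr F Egen) : Erel q1 q2 q3 x y -> ev x =1 ev y.
Proof.
case=> [m n|m n|b m n|b m n|m n|b c j k|b|b||].
- exact: relation_ee.
- exact: relation_ff.
- exact: relation_psie.
- exact: relation_psif.
- exact: relation_ef.
- exact: relation_psipsi.
- by move=> v; rewrite /= psi_op0 scale1r.
- by move=> v; rewrite /= psi_op0 scale1r.
- exact: relation_eee.
- exact: relation_fff.
Qed.

Lemma tensorZ (c : 'I_N -> F) i :
  tensor (fun s => c s *: Vbasis F (i s)) = (\prod_s c s) *: tbasis F i.
Proof.
apply/malgP => j; rewrite mcoeffZ /tbasis !tensorE -big_split.
by apply: eq_bigr => s _; rewrite mcoeffZ.
Qed.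

Lemma tensor_action_unique :
  exists! act : Ealg q1 q2 q3 -> Vtensor F N -> Vtensor F N,
    [/\ algebra_action act,
        forall i (n : int),
          (1 - q1) *: act (Ee q1 q2 q3 n) (tbasis F i) =
          \sum_(s < N)
            ((\prod_(l < N | (l < s)%N)
                gamma q1 q2 q3 (i l) (u l) (q1 ^ i s * u s))
             * delta_coef (q1 ^ i s * u s) n)
            *: tbasis F (shift i s 1),
        forall i (n : int),
          - (1 - q1^-1) *: act (Ef q1 q2 q3 n) (tbasis F i) =
          \sum_(s < N)
            (delta_coef (q1 ^ (i s - 1) * u s) n
             * \prod_(l < N | (s < l)%N)
                 gamma q1 q2 q3 (i l) (u l) (q1 ^ (i s - 1) * u s))
            *: tbasis F (shift i s (- 1))
      & forall b i (k : nat),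
          act (Epsi q1 q2 q3 b k) (tbasis F i) =
          \sum_(c : {ffun 'I_N -> 'I_k.+1} | (\sum_s c s == k)%N)
            tensor (fun s => Vpsi q1 q2 q3 b (u s) (c s) (i s))].
Proof.
have q1_sub : 1 - q1 != 0 by rewrite subr_eq0 eq_sym.
have q1V_sub : - (1 - q1^-1) != 0 by rewrite oppr_eq0 subr_eq0 eq_sym.
have [act actP act_gen] := @Ealg_action_exists F q1 q2 q3 (Vtensor F N)
  generator_op generator_op_linear generator_op_rel.
have eE i n : (1 - q1) *: act (Ee q1 q2 q3 n) (tbasis F i) =
    \sum_(s < N) ((\prod_(l < N | (l < s)%N)
      gamma q1 q2 q3 (i l) (u l) (q1 ^ i s * u s)) *
      delta_coef (q1 ^ i s * u s) n) *: tbasis F (shift i s 1).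
  rewrite tbasisE act_gen /= /e_op current_opU scaler_sumr.
  apply: eq_bigr => s _; rewrite scalerA tbasisE; congr (_ *: _).
  rewrite -mulrA mulVKf //; congr (_ * _); apply: eq_bigr => l _.
  by rewrite gamma_atE // e_point_neq0.
have fE i n : - (1 - q1^-1) *: act (Ef q1 q2 q3 n) (tbasis F i) =
    \sum_(s < N) (delta_coef (q1 ^ (i s - 1) * u s) n *
      \prod_(l < N | (s < l)%N)
        gamma q1 q2 q3 (i l) (u l) (q1 ^ (i s - 1) * u s)) *: tbasis F (shift i s (- 1)).
  rewrite tbasisE act_gen /= /f_op current_opU scaler_sumr.
  apply: eq_bigr => s _; rewrite scalerA tbasisE; congr (_ *: _).
  rewrite -mulrA mulVKf // mulrC; congr (_ * _); apply: eq_bigr => l _.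
  by rewrite f_gamma gamma_atE // f_point_neq0.
have psiE b i k : act (Epsi q1 q2 q3 b k) (tbasis F i) =
    \sum_(c : {ffun 'I_N -> 'I_k.+1} | (\sum_s c s == k)%N)
      tensor (fun s => Vpsi q1 q2 q3 b (u s) (c s) (i s)).
  rewrite tbasisE act_gen /= /psi_op linear_extensionU.
  rewrite /eigenseries /psi_eigenseries coef_series_prod scaler_suml.
  apply: eq_bigr => c _; rewrite tensorZ tbasisE; congr (_ *: _).
  by apply: eq_bigr => s _; rewrite gamma_coefE.
exists act; split=> // act' [actP' e' f' psi'].
apply: Ealg_action_basis_ext => // [n i|n i|b k i]; rewrite -tbasisE.
- by apply: (scalerI q1_sub); rewrite eE e'.
- by apply: (scalerI q1V_sub); rewrite fE f'.
- by rewrite psiE psi'.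
Qed.

End Action.

(** * The theorem *)

Theorem lemma3p6 (R : realType) (q1 q2 q3 : R[i])
    (q1_neq0 : q1 != 0) (q2_neq0 : q2 != 0) (q3_neq0 : q3 != 0)
    (q1_neq1 : q1 != 1) (q2_neq1 : q2 != 1) (q3_neq1 : q3 != 1)
    (q123 : q1 * q2 * q3 = 1)
    (N : nat) (u : 'I_N -> R[i]) (u_neq0 : forall s, u s != 0)
    (u_generic : forall (s t : 'I_N) (k : int),
       (s < t)%N -> u s / u t != q1 ^ k) :
  exists! act : Ealg q1 q2 q3 -> Vtensor R[i] N -> Vtensor R[i] N,
    [/\ algebra_action act,
        forall (i : {ffun 'I_N -> int}) (n : int),
          (1 - q1) *: act (Ee q1 q2 q3 n) (tbasis R[i] i) =
          \sum_(s < N)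
            ((\prod_(l < N | (l < s)%N)
                gamma q1 q2 q3 (i l) (u l) (q1 ^ i s * u s))
             * delta_coef (q1 ^ i s * u s) n)
            *: tbasis R[i] (shift i s 1),
        forall (i : {ffun 'I_N -> int}) (n : int),
          - (1 - q1^-1) *: act (Ef q1 q2 q3 n) (tbasis R[i] i) =
          \sum_(s < N)
            (delta_coef (q1 ^ (i s - 1) * u s) n
             * \prod_(l < N | (s < l)%N)
                 gamma q1 q2 q3 (i l) (u l) (q1 ^ (i s - 1) * u s))
            *: tbasis R[i] (shift i s (- 1))
      & forall (b : bool) (i : {ffun 'I_N -> int}) (k : nat),
          act (Epsi q1 q2 q3 b k) (tbasis R[i] i) =
          \sum_(c : {ffun 'I_N -> 'I_k.+1} | (\sum_s c s == k)%N)
            tensor (fun s => Vpsi q1 q2 q3 b (u s) (c s) (i s))].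
Proof. exact: tensor_action_unique. Qed.
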